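(* Let $A$ be an $n\times n$ dilation matrix, and let $D$ be a digit set for $A$ such that $A$ yields a radix representation for $\mathbb{Z}^n$ with digit set $D$. Let $T=T(A,D)$. Then $\phi=\chi_T$ (the characteristic function of $T$) is the scaling function for a multiresolution analysis associated with $A$. In particular, if the smallest singular value $\mu$ of $A$ satisfies $\mu>2$ and if $D=A(F)\cap\mathbb{Z}^n$ with $F=[-\frac12,\frac12)^n$, then $\phi=\chi_T$, with $T=T(A,D)$, is the scaling function for a multiresolution analysis associated with $A$.
   Context: A dilation matrix (for $\mathbb{Z}^n$) is an $n\times n$ matrix $A$ with integer entries, all of whose eigenvalues $\lambda$ satisfy $|\lambda|>1$. A digit set for $A$ is a complete set $D\subset\mathbb{Z}^n$ of coset representatives of $\mathbb{Z}^n/A(\mathbb{Z}^n)$ (exactly one element from each coset) with $\mathbf{0}\in D$. $A$ yields a radix representation (for $\mathbb{Z}^n$) with digit set $D$ if for every $x\in\mathbb{Z}^n$ there exist a nonnegative integer $N=N(x)$ and digits $d_0,d_1,\ldots,d_N\in D$ such that $x=\sum_{j=0}^{N}A^jd_j$. $T(A,D):=\{\xi\in\mathbb{R}^n:\ \xi=\sum_{j=1}^{\infty}A^{-j}d_j,\ d_j\in D \text{ for all } j\ge 1\}$. A multiresolution analysis (MRA) associated with a dilation matrix $A$ is a nested sequence of subspaces $\cdots\subset V_{-1}\subset V_0\subset V_1\subset\cdots$ of $L^2(\mathbb{R}^n)$ satisfying: (1) $\overline{\bigcup_{j\in\mathbb{Z}}V_j}=L^2(\mathbb{R}^n)$; (2)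 $\bigcap_{j\in\mathbb{Z}}V_j=\{0\}$; (3) $f(x)\in V_j$ if and only if $f(Ax)\in V_{j+1}$, for all $j\in\mathbb{Z}$; (4) $f(x)\in V_0$ if and only if $f(x-k)\in V_0$ for all $k\in\mathbb{Z}^n$; and (5) there exists a function $\phi\in V_0$, called a scaling function, such that $\{\phi(x-k):\ k\in\mathbb{Z}^n\}$ is a complete orthonormal basis for $V_0$. *)

(* Defs.v *)
From HB Require Import structures.
From mathcomp Require Import all_boot all_order all_algebra.
From mathcomp Require Import complex.
From mathcomp Require Import all_classical all_reals all_analysis.

Set Implicit Arguments.
Unset Strict Implicit.
Unset Printing Implicit Defensive.

Import Order.TTheory GRing.Theory Num.Theory.
Import numFieldNormedType.Exports.

Local Open Scope classical_set_scope.
Local Open Scope ring_scope.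
Local Open Scope complex_scope.

(* R^n is 'cV[R]_n; the sigma-algebra generated by the coordinate functions is
   the Borel one. *)
Section measurable_colvec.
Context (R : realType) (n : nat).

Let coor (i : 'I_n) (v : 'cV[R]_n) : R := v i ord0.

Let colvec_set0 : g_sigma_preimage coor set0.
Proof. exact: sigma_algebra0. Qed.

Let colvec_setC B : g_sigma_preimage coor B -> g_sigma_preimage coor (~` B).
Proof. exact: sigma_algebraC. Qed.

Let colvec_bigcup (F : _^nat) : (forall i, g_sigma_preimage coor (F i)) ->
  g_sigma_preimage coor (\bigcup_i (F i)).
Proof. exact: sigma_algebra_bigcup. Qed.

HB.instance Definition _ := @isMeasurable.Build default_measure_display
  'cV[R]_n (g_sigma_preimage coor) colvec_set0 colvec_setC colvec_bigcup.

Lemma measurable_coor (i : 'I_n) :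
  measurable_fun [set: 'cV[R]_n] (fun v : 'cV[R]_n => v i ord0 : R).
Proof.
move=> _ Y mY; rewrite setTI; apply: sub_sigma_algebra => /=.
rewrite -bigcup_seq/=; exists i => /=; first by rewrite mem_index_enum.
by exists Y => //; rewrite setTI.
Qed.

Lemma measurable_fun_coorP d (T : measurableType d) (f : T -> 'cV[R]_n) :
  (forall i, measurable_fun [set: T] (fun x => f x i ord0 : R)) ->
  measurable_fun [set: T] f.
Proof.
move=> mf _ Y mY; rewrite setTI.
suff : g_sigma_preimage coor `<=` [set B | measurable (f @^-1` B)]
  by apply.
apply: smallest_sub.
  split=> [|B mB|F mF] /=.
  - by rewrite preimage_set0.
  - by rewrite setTD -preimage_setC; exact: measurableC.
  - by rewrite preimage_bigcup; exact: bigcupT_measurable.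
rewrite -bigcup_seq => B [i _ [C mC <-]] /=.
by rewrite setTI -comp_preimage -[X in measurable X]setTI; exact: mf.
Qed.

End measurable_colvec.

Section lebesgue_step.
Context (R : realType) (n : nat).
Variable m : {sigma_finite_measure set 'cV[R]_n -> \bar R}.

Definition colvec_cons (p : measurableTypeR R * 'cV[R]_n) : 'cV[R]_n.+1 :=
  col_mx (p.1 : R)%:M p.2.

Lemma colvec_cons0 p : colvec_cons p ord0 ord0 = p.1.
Proof. by rewrite mxE; case: splitP => // j _; rewrite mxE ord1 eqxx. Qed.

Lemma colvec_consS p i : colvec_cons p (lift ord0 i) ord0 = p.2 i ord0.
Proof.
rewrite mxE; case: splitP => [j|j [/val_inj->]//].
by rewrite ord1.
Qed.

Lemma measurable_colvec_cons : measurable_fun setT colvec_cons.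
Proof.
apply: measurable_fun_coorP => i; case: (unliftP ord0 i) => [j|] ->.
  under eq_fun do rewrite colvec_consS.
  by apply: (measurableT_comp (measurable_coor j)); exact: measurable_snd.
by under eq_fun do rewrite colvec_cons0; exact: measurable_fst.
Qed.

(* The product of Lebesgue measure on R and m, carried over to 'cV[R]_n.+1 by
   stacking the coordinates. *)
Definition lebesgue_step : set 'cV[R]_n.+1 -> \bar R :=
  pushforward (lebesgue_measure \x m)%E colvec_cons.

Let lebesgue_step0 : lebesgue_step set0 = 0%E.
Proof. by rewrite /lebesgue_step /pushforward preimage_set0 measure0. Qed.

Let lebesgue_step_ge0 B : (0 <= lebesgue_step B)%E.
Proof. by rewrite /lebesgue_step /pushforward measure_ge0. Qed.

Let lebesgue_step_sigma_additive : semi_sigma_additive lebesgue_step.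
Proof.
move=> F mF tF mUF; rewrite /lebesgue_step /pushforward preimage_bigcup.
apply: measure_semi_sigma_additive.
- by move=> k; rewrite -[X in measurable X]setTI; exact: measurable_colvec_cons.
- apply/trivIsetP => /= i j _ _ ij; rewrite -preimage_setI.
  by move/trivIsetP : tF => /(_ _ _ _ _ ij) ->//; rewrite preimage_set0.
- rewrite -preimage_bigcup -[X in measurable X]setTI.
  exact: measurable_colvec_cons.
Qed.

HB.instance Definition _ := isMeasure.Build _ _ _ lebesgue_step
  lebesgue_step0 lebesgue_step_ge0 lebesgue_step_sigma_additive.

Let lebesgue_step_sigma_finite : sigma_finite setT lebesgue_step.
Proof.
have [F FT Foo] : sigma_finite setT (lebesgue_measure \x m)%E.
  have /sigma_finiteP[F [TF ndF Foo]] := sigma_finiteT (@lebesgue_measure R).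
  have /sigma_finiteP[G [TG ndG Goo]] := sigma_finiteT m.
  exists (fun k => F k `*` G k).
    rewrite -setXTT TF TG predeqE => -[x y]; split.
      move=> [/= [k _ Fkx] [l _ Gly]]; exists (maxn k l) => //; split.
      - by move: x Fkx; exact/subsetPset/ndF/leq_maxl.
      - by move: y Gly; exact/subsetPset/ndG/leq_maxr.
    by move=> [k _ []/= ? ?]; split; exists k.
  move=> k; have [? ?] := Foo k; have [? ?] := Goo k.
  split; first exact: measurableX.
  by rewrite product_measure1E// lte_mul_pinfty// ge0_fin_numE.
pose uncons (v : 'cV[R]_n.+1) : measurableTypeR R * 'cV[R]_n :=
  (v ord0 ord0, \col_i v (lift ord0 i) ord0).
have unconsK : cancel colvec_cons uncons.
  move=> [x v]; rewrite /uncons colvec_cons0; congr (_, _).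
  by apply/colP => i; rewrite mxE colvec_consS.
have muncons : measurable_fun setT uncons.
  apply: measurable_fun_pair; first exact: measurable_coor.
  apply: measurable_fun_coorP => i.
  rewrite (_ : (fun _ => _) = fun v : 'cV[R]_n.+1 => v (lift ord0 i) ord0).
    exact: measurable_coor.
  by apply/funext => v; rewrite mxE.
exists (fun k => uncons @^-1` F k).
  by rewrite -preimage_bigcup -FT preimage_setT.
move=> k; have [mFk Fkoo] := Foo k; split.
  by rewrite -[X in measurable X]setTI; exact: muncons.
rewrite /lebesgue_step /pushforward -comp_preimage.
by rewrite (_ : uncons \o _ = id) ?preimage_id//; exact/funext.
Qed.

HB.instance Definition _ := Measure_isSigmaFinite.Build _ _ _ lebesgue_step
  lebesgue_step_sigma_finite.

End lebesgue_step.

Fixpoint lebesgue_colvec (R : realType) (n : nat) :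
    {sigma_finite_measure set 'cV[R]_n -> \bar R} :=
  if n is n'.+1 then lebesgue_step (lebesgue_colvec R n')
  else \d_(0 : 'cV[R]_0).

(* L^2(R^n) is the complex Hilbert space.  Its elements are represented by
   functions rather than by classes: two functions equal almost everywhere
   represent the same element.  Borel measurability loses nothing, every
   Lebesgue measurable function being a.e. equal to a Borel one. *)
Section L2.
Context (R : realType) (n : nat).
Local Notation mu := (lebesgue_colvec R n).
Implicit Types f g : 'cV[R]_n -> R[i].

Definition cmeasurable f :=
  measurable_fun [set: 'cV[R]_n] (fun x => complex.Re (f x)) /\
  measurable_fun [set: 'cV[R]_n] (fun x => complex.Im (f x)).

Definition L2norm f : \bar R := Lnorm mu 2%:E (fun x => (complex.Re `|f x|)%:E).

Definition L2 : set ('cV[R]_n -> R[i]) :=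
  [set f | cmeasurable f /\ (L2norm f < +oo)%E].

Definition L2dot f g : R[i] :=
  (\int[mu]_x complex.Re (f x * (g x)^*))%R +i* (\int[mu]_x complex.Im (f x * (g x)^*))%R.

Definition L2null : set ('cV[R]_n -> R[i]) :=
  [set f | L2 f /\ f = cst 0 %[ae mu]].

Definition L2closure (S : set ('cV[R]_n -> R[i])) : set ('cV[R]_n -> R[i]) :=
  [set f | L2 f /\
     forall e : R, 0 < e -> exists2 g, S g & (L2norm (f \- g)%R < e%:E)%E].

(* [csub_closed] also makes V stable under a.e. equality, so that V is a
   subspace of L^2 and not only of the space of representatives. *)
Record closed_subspace (V : set ('cV[R]_n -> R[i])) : Prop := ClosedSubspace {
  csub_L2 : V `<=` L2;
  csub_0 : V (cst 0);
  csub_add : forall f g, V f -> V g -> V (f \+ g);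
  csub_scale : forall (a : R[i]) f, V f -> V (fun x => a * f x);
  csub_closed : L2closure V `<=` V
}.

Definition lin_span (I : eqType) (e : I -> 'cV[R]_n -> R[i]) :
    set ('cV[R]_n -> R[i]) :=
  [set f | exists (s : seq I) (c : I -> R[i]),
     f = (fun x => \sum_(k <- s) c k * e k x)].

(* In a closed subspace V, [conb_mem] and [conb_complete] say that V is the
   closed linear span of the family. *)
Record complete_orthonormal_basis (I : eqType) (V : set ('cV[R]_n -> R[i]))
    (e : I -> 'cV[R]_n -> R[i]) : Prop := CompleteOrthonormalBasis {
  conb_mem : forall k, V (e k);
  conb_orthonormal : forall k l, L2dot (e k) (e l) = (k == l)%:R;
  conb_complete : V `<=` L2closure (lin_span e)
}.

End L2.

Definition intmx (K : pzRingType) (m n : nat) (M : 'M[int]_(m, n)) :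
  'M[K]_(m, n) := map_mx (fun z : int => z%:~R) M.

Section MRA.
Context (R : realType) (n : nat).
Implicit Types (A : 'M[int]_n) (D : set 'cV[int]_n).

(* [eigenvalue] refers to row eigenvectors; the spectrum is the same. *)
Definition dilation_matrix A : Prop :=
  forall lambda : R[i], eigenvalue (intmx R[i] A) lambda -> 1 < `|lambda|.

Definition scaling_function (V : int -> set ('cV[R]_n -> R[i]))
    (phi : 'cV[R]_n -> R[i]) : Prop :=
  V 0 phi /\
  complete_orthonormal_basis (V 0)
    (fun (k : 'cV[int]_n) x => phi (x - intmx R k)).

Record multiresolution_analysis A (V : int -> set ('cV[R]_n -> R[i])) : Prop :=
MultiresolutionAnalysis {
  mra_subspace : forall j, closed_subspace (V j);
  mra_nested : forall j, V j `<=` V (j + 1);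
  mra_dense : L2closure (\bigcup_j V j) = @L2 R n;
  mra_trivial : \bigcap_j V j = @L2null R n;
  mra_dilation : forall j f,
    V j f <-> V (j + 1) (fun x => f (intmx R A *m x));
  mra_translation : forall f (k : 'cV[int]_n),
    V 0 f <-> V 0 (fun x => f (x - intmx R k));
  mra_scaling : exists phi, scaling_function V phi
}.

Definition is_scaling_function_for A (phi : 'cV[R]_n -> R[i]) : Prop :=
  exists2 V, multiresolution_analysis A V & scaling_function V phi.

Definition digit_set A D : Prop :=
  D 0 /\
  forall x, exists! d, D d /\ exists y : 'cV[int]_n, x = d + A *m y.

Definition radix_representation A D : Prop :=
  forall x, exists (N : nat) (d : nat -> 'cV[int]_n),
    (forall j, (j <= N)%N -> D (d j)) /\
    x = \sum_(0 <= j < N.+1) A ^+ j *m d j.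

Definition tile A D : set 'cV[R]_n :=
  [set xi | exists d : nat -> 'cV[int]_n,
     (forall j, (1 <= j)%N -> D (d j)) /\
     (fun N : nat => \sum_(1 <= j < N.+1)
        invmx (intmx R A) ^+ j *m intmx R (d j)) @ \oo --> xi].

Definition tile_indicator A D (x : 'cV[R]_n) : R[i] := \1_(tile A D) x.

Definition singular_value A (s : R) : Prop :=
  0 <= s /\ eigenvalue ((intmx R A)^T *m intmx R A) (s ^+ 2).

Definition smallest_singular_value A (s : R) : Prop :=
  singular_value A s /\ forall t, singular_value A t -> s <= t.

Definition half_open_cube : set 'cV[R]_n :=
  [set x | forall i, - 2^-1 <= x i ord0 < 2^-1].

Definition cube_digits A : set 'cV[int]_n :=
  [set d | exists2 x, half_open_cube x & intmx R A *m x = intmx R d].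

End MRA.

(* Main.v *)
Require Import Defs.
From HB Require Import structures.
From mathcomp Require Import all_boot all_order all_algebra.
From mathcomp Require Import complex.
From mathcomp Require Import all_classical all_reals all_analysis.
From mathcomp Require Import measurable_realfun.
From mathcomp Require Import spectral sesquilinear.
From mathcomp Require Import ring lra zify.

Set Implicit Arguments.
Unset Strict Implicit.
Unset Printing Implicit Defensive.

Import Order.TTheory GRing.Theory Num.Theory.
Import numFieldNormedType.Exports.

Local Open Scope classical_set_scope.
Local Open Scope ring_scope.

(** The characteristic function of the tile T works because the translates of T
    by integer vectors tile space, and because the tiles of one level are unions
    of tiles of the next.

    T is the union over the digits d of the pieces of points x such that
    A x - d is in T.  Let mu be Lebesgue measure.  Each piece has measure
    mu(T) / #D, since multiplication by A scales measure by the index of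
    A(Z^n) in Z^n, which is #D: the preimages of the unit cube under the maps
    x |-> A x - d form together a fundamental domain of Z^n.  So the measures of
    the pieces add up to mu(T), and the pieces overlap in null sets only.  A
    radix representation writes an integer vector as d + A m with a shorter m;
    by induction on its length, T + k and T + l overlap in a null set for all
    k <> l ([tile_ae_packs]).  The translates also cover space ([tile_covers]):
    subtracting an integer part from A^N x, and peeling the digits off that
    integer part, places x within the N-th approximation of an integer translate
    of T, and finitely many translates come into play.  A set that packs and
    covers has the measure of the unit cube, so mu(T) = 1.

    The translates of chi_T are therefore orthonormal.  Let V_0 be their closed
    span and V_j the set of f such that f(A^(-j) .) is in V_0.
    - V_0 is contained in V_1 because chi_T(A^(-1) .) is almost everywhere the
      sum of the translates of chi_T by the digits.
    - The intersection is trivial: an element g of V_0 is constant on tiles of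
      measure 1, whence |g|^2 <= 4 ||g||^2 almost everywhere, and for f in
      V_(-m) the function f(A^m .) has squared norm #D^(-m) ||f||^2.  So an f in
      all of them vanishes ([modulus_lt1] gives #D > 1).
    - The union is dense: the tiles of level m that lie inside a bounded open
      set O fill it as m grows, because their diameters tend to 0
      ([dilation_decay]).  So the closure of the union contains the indicator of
      O, and a closed subspace with this property is all of L^2, by Dynkin's
      theorem and approximation by simple functions ([L2_sub_closed_subspace]).

    The scaling of measure by a matrix comes from the uniqueness of
    translation-invariant measure, proved by one exchange of integrals
    ([mulmx_preimage_proportional]), and the decay of the powers of A^(-1) from
    the Cayley-Hamilton theorem, one eigenvalue at a time.

    For the digits in A(F), F the half-open cube, dividing x by A means rounding
    A^(-1) x coordinatewise.  Rounding at most doubles the length, and A^(-1)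
    more than halves it, as the singular values of A exceed 2.  So repeated
    division reaches 0 ([cube_digits_radix]): A yields a radix representation. *)

(** * Lebesgue measure on column vectors *)

Section change_of_variables.
Context d (T : measurableType d) (R : realType).
Variable mu : {measure set T -> \bar R}.
Variables (phi : T -> T) (c : R).
Hypotheses (mphi : measurable_fun [set: T] phi) (c_ge0 : 0 <= c).
Hypothesis phi_mu : forall E, measurable E -> mu (phi @^-1` E) = (c%:E * mu E)%E.

Lemma ge0_integral_scaled (f : T -> \bar R) :
  measurable_fun [set: T] f -> (forall x, 0 <= f x)%E ->
  (\int[mu]_x f (phi x) = c%:E * \int[mu]_x f x)%E.
Proof.
move=> mf f0.
transitivity (\int[pushforward mu phi]_x f x)%E.
  by rewrite ge0_integral_pushforward// preimage_setT.
rewrite (_ : c = (NngNum c_ge0)%:num)// -ge0_integral_mscale//.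
apply: eq_measure_integral => E mE _; exact: phi_mu.
Qed.

End change_of_variables.

Section lebesgue_translation.
Context (R : realType).

Lemma lebesgue_measure_translate (a : R) (E : set (measurableTypeR R)) :
  measurable E ->
  pushforward (@lebesgue_measure R)
    ((fun x => x - a) : measurableTypeR R -> measurableTypeR R) E =
  lebesgue_measure E.
Proof.
move=> mE; apply/esym/lebesgue_measure_unique => //=.
  by apply: measurable_funB; [exact: measurable_id|exact: measurable_cst].
move=> ? _ [[u v]] _ <-; rewrite /pushforward.
rewrite (_ : _ @^-1` _ = `]u + a, v + a]%classic); last first.
  by apply/seteqP; split=> x /=; rewrite !in_itv /= ltrBrDr lerBlDr.
rewrite !lebesgue_measure_itv /= !lte_fin ltrD2r; case: ifP => // _.
by rewrite -!EFinD; congr (_%:E); ring.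
Qed.
End lebesgue_translation.

Section lebesgue_colvec_theory.
Context (R : realType).

Lemma measurable_colvec_translate n (a : 'cV[R]_n) :
  measurable_fun [set: 'cV[R]_n] (fun x : 'cV[R]_n => x - a).
Proof.
apply: measurable_fun_coorP => i.
rewrite (_ : (fun _ => _) = fun x : 'cV[R]_n => x i ord0 - a i ord0); last first.
  by apply/funext => x; rewrite !mxE.
by apply: measurable_funB; [exact: measurable_coor|exact: measurable_cst].
Qed.

Lemma measurable_mulmx n m (M : 'M[R]_(m, n)) :
  measurable_fun [set: 'cV[R]_n] (fun x : 'cV[R]_n => M *m x).
Proof.
apply: measurable_fun_coorP => i.
rewrite (_ : (fun _ => _) = fun x : 'cV[R]_n => \sum_j M i j * x j ord0); last first.
  by apply/funext => x; rewrite !mxE.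
apply: measurable_sum => j; apply: measurable_funM; first exact: measurable_cst.
exact: measurable_coor.
Qed.

Lemma preimage_measurable d d' (T : measurableType d) (U : measurableType d')
  (f : T -> U) (E : set U) : measurable_fun [set: T] f -> measurable E ->
  measurable (f @^-1` E).
Proof. by move=> mf mE; rewrite -[X in measurable X]setTI; exact: mf. Qed.

(** Induction on the dimension: a section of a translated set is a translate
    of a section, so only translations of the line are left. *)
Lemma lebesgue_colvec_translate n (a : 'cV[R]_n) (E : set 'cV[R]_n) :
  measurable E ->
  lebesgue_colvec R n ((fun x => x - a) @^-1` E) = lebesgue_colvec R n E.
Proof.
elim: n a E => [|n IHn] a E mE.
  rewrite (_ : _ @^-1` _ = E)//; apply/funext => x /=.
  by rewrite (_ : x - a = x)//; apply/colP; case.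
rewrite /= /lebesgue_step /pushforward /product_measure1.
set F := colvec_cons (n := n) @^-1` E.
have mF : measurable F by apply: preimage_measurable mE; exact: measurable_colvec_cons.
pose a' : 'cV[R]_n := \col_i a (lift ord0 i) ord0.
pose g x := lebesgue_colvec R n (xsection F x).
have mg : measurable_fun setT g by exact: measurable_fun_xsection.
pose phi := (fun x => x - a ord0 ord0) : measurableTypeR R -> measurableTypeR R.
transitivity (\int[lebesgue_measure]_x g (phi x))%E.
  apply: eq_integral => x _ /=.
  rewrite /g -[RHS](IHn a'); last exact: measurable_xsection.
  apply: (congr1 (lebesgue_colvec R n)); apply/funext => y; rewrite /xsection /=.
  apply/propext; rewrite !inE /F /=.
  rewrite (_ : colvec_cons _ - a = colvec_cons (phi x, y - a'))//.
  apply/colP => i; rewrite mxE [X in _ + X]mxE; case: (unliftP ord0 i) => [j|] ->.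
    by rewrite !colvec_consS !mxE.
  by rewrite !colvec_cons0.
rewrite (ge0_integral_scaled (c := 1)) ?mul1e//.
- by apply: measurable_funB; [exact: measurable_id|exact: measurable_cst].
- by move=> A mA; rewrite mul1e; exact: lebesgue_measure_translate.
Qed.

Definition box n (a b : R) : set 'cV[R]_n := [set x | forall i, a <= x i ord0 < b].

Lemma measurable_box n a b : measurable (@box n a b).
Proof.
rewrite (_ : box a b = \bigcap_(i in [set: 'I_n]) ((fun x : 'cV[R]_n => x i ord0) @^-1` `[a, b[%classic)); last first.
  apply/seteqP; split=> [x Hx i _ /=|x Hx i]; first by rewrite in_itv /= Hx.
  by have /= := Hx i I; rewrite in_itv.
apply: fin_bigcap_measurable => // i _.
by apply: preimage_measurable; [exact: measurable_coor|exact: measurable_itv].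
Qed.

Lemma lebesgue_colvec_box n (a b : R) : a <= b ->
  lebesgue_colvec R n (box a b) = ((b - a) ^+ n)%:E.
Proof.
move=> ab; elim: n => [|n IHn].
  by rewrite /= diracE mem_set// => -[].
rewrite /= /lebesgue_step /pushforward.
rewrite (_ : _ @^-1` _ = `[a, b[%classic `*` box a b); last first.
  apply/seteqP; split=> [[x v] /= H|[x v] /= [xab H]].
    split; first by have := H ord0; rewrite colvec_cons0 in_itv.
    by move=> i; have := H (lift ord0 i); rewrite colvec_consS.
  move=> i; case: (unliftP ord0 i) => [j|] ->; first by rewrite colvec_consS.
  by rewrite colvec_cons0; move: xab; rewrite in_itv.
rewrite product_measure1E//; last exact: measurable_box.
rewrite IHn exprS EFinM; congr (_ * _)%E.
have := lebesgue_measure_itv (`[a, b[ : interval R); rewrite /= lte_fin => ->.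
by case: ltgtP ab => // -> _; rewrite subrr.
Qed.

End lebesgue_colvec_theory.

Section haar.
Context (R : realType) (n : nat).
Local Notation mu := (lebesgue_colvec R n).
Implicit Types (E : set 'cV[R]_n) (M : 'M[R]_n).

Definition unit_cube : set 'cV[R]_n := box 0 1.

Lemma lebesgue_unit_cube : mu unit_cube = 1%E.
Proof. by rewrite lebesgue_colvec_box// subr0 expr1n. Qed.

Lemma lebesgue_colvec_bounded E (r : R) : measurable E ->
  (forall x, E x -> forall i, `|x i ord0| <= r) -> (mu E < +oo)%E.
Proof.
move=> mE Er; pose b := `|r| + 1.
have b0 : - b <= b by rewrite ge0_cp// addr_ge0.
apply: (@le_lt_trans _ _ (mu (box (- b) b))); last first.
  by rewrite lebesgue_colvec_box// ltry.
apply: le_measure; rewrite ?inE//; first exact: measurable_box.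
move=> x Ex i; have /le_lt_trans : `|x i ord0| <= `|r| by rewrite (le_trans (Er _ Ex i))// ler_norm.
by move=> /(_ b); rewrite ltrDl ltr01 ltr_norml => /(_ isT) /andP[/ltW -> ->].
Qed.

Lemma integral_indicMr E (c : \bar R) : measurable E -> (0 <= c)%E ->
  (\int[mu]_x ((\1_E x)%:E * c) = mu E * c)%E.
Proof.
move=> mE c0; rewrite ge0_integralZr//; first by rewrite integral_indic// setIT.
exact: measurableT_comp.
Qed.

Lemma measure_sections_swap (E : set ('cV[R]_n * 'cV[R]_n)) : measurable E ->
  (\int[mu]_x mu [set y | E (x, y)] = \int[mu]_y mu [set x | E (x, y)])%E.
Proof.
move=> mE; have := indic_fubini_tonelli mu mu mE.
rewrite indic_fubini_tonelli_FE// indic_fubini_tonelli_GE// => H.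
have -> : (fun x => mu [set y | E (x, y)]) = mu \o xsection E.
  apply/funext => x /=; apply: (congr1 mu); apply/funext => y.
  by rewrite /xsection; apply/propext; split; rewrite /= inE.
rewrite H; apply: eq_integral => y _ /=; apply: (congr1 mu); apply/funext => x.
by rewrite /ysection; apply/propext; split; rewrite /= inE.
Qed.

(** Uniqueness of translation-invariant measure, with Q the unit cube.  The
    measure of the pairs (x, y) such that M x is in E and M x + y is in Q is
    the left-hand side when y is integrated first.  Integrating x first, the
    substitution of x - M^(-1) y for x turns it into the measure of the pairs
    such that M x - y is in E and M x is in Q, which is the right-hand side. *)
Lemma mulmx_preimage_proportional M E : M \in unitmx -> measurable E ->
  mu ((fun x => M *m x) @^-1` E) =
  (mu ((fun x => M *m x) @^-1` unit_cube) * mu (-%R @^-1` E))%E.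
Proof.
move=> uM mE; set Q := unit_cube.
have mQ : measurable Q by exact: measurable_box.
have mM : measurable_fun setT (fun x : 'cV[R]_n => M *m x) by exact: measurable_mulmx.
have mM1 : measurable_fun setT (fun z : 'cV[R]_n * 'cV[R]_n => M *m z.1).
  by apply: measurableT_comp => //; exact: measurable_fst.
have mN : measurable_fun setT (fun y : 'cV[R]_n => - y).
  apply: measurable_fun_coorP => i; under eq_fun do rewrite mxE.
  by apply: measurableT_comp => //; exact: measurable_coor.
have mM2 (s : R) : measurable_fun setT
    (fun z : 'cV[R]_n * 'cV[R]_n => M *m z.1 + s *: z.2).
  apply: measurable_fun_coorP => i; under eq_fun do rewrite mxE.
  apply: measurable_funD.
    by apply: (measurableT_comp (measurable_coor i)); exact: mM1.
  under eq_fun do rewrite mxE.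
  apply: measurable_funM; first exact: measurable_cst.
  by apply: (measurableT_comp (measurable_coor i)); exact: measurable_snd.
have mu_translate (a : 'cV[R]_n) F : measurable F -> mu [set x | F (a + x)] = mu F.
  move=> mF; rewrite -[RHS](lebesgue_colvec_translate (- a))//.
  by apply: (congr1 mu); apply/funext => x /=; rewrite opprK addrC.
pose E1 := ((fun z : 'cV[R]_n * 'cV[R]_n => M *m z.1) @^-1` E) `&`
           ((fun z : 'cV[R]_n * 'cV[R]_n => M *m z.1 + 1 *: z.2) @^-1` Q).
pose E2 := ((fun z : 'cV[R]_n * 'cV[R]_n => M *m z.1 + -1 *: z.2) @^-1` E) `&`
           ((fun z : 'cV[R]_n * 'cV[R]_n => M *m z.1) @^-1` Q).
have mE1 : measurable E1 by apply: measurableI; exact: preimage_measurable.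
have mE2 : measurable E2 by apply: measurableI; exact: preimage_measurable.
have I1 : (\int[mu]_x mu [set y | E1 (x, y)] = mu ((fun x => M *m x) @^-1` E))%E.
  rewrite -[RHS]mule1 -integral_indicMr//; last exact: preimage_measurable.
  apply: eq_integral => x _; rewrite indicE.
  have [xE|xE] := pselect (E (M *m x)); last first.
    rewrite memNset// mul0e [X in mu X](_ : _ = set0) ?measure0//.
    by apply/seteqP; split => // y [] /=.
  rewrite mem_set// mul1e -lebesgue_unit_cube -(mu_translate (M *m x) Q)//.
  by apply: (congr1 mu); apply/seteqP; split => y /=; rewrite /E1 /= scale1r; [case|].
have I2 : (\int[mu]_x mu [set y | E2 (x, y)] =
    mu ((fun x => M *m x) @^-1` Q) * mu (-%R @^-1` E))%E.
  rewrite -integral_indicMr//; last exact: preimage_measurable.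
  apply: eq_integral => x _; rewrite indicE.
  have [xQ|xQ] := pselect (Q (M *m x)); last first.
    rewrite memNset// mul0e [X in mu X](_ : _ = set0) ?measure0//.
    by apply/seteqP; split => // y [] /=.
  rewrite mem_set// mul1e -[RHS](mu_translate (- (M *m x)) (-%R @^-1` E)); last exact: preimage_measurable.
  apply: (congr1 mu); apply/seteqP; split => y /=;
    rewrite /E2 /= scaleN1r opprD opprK; last by [].
  by case.
rewrite -I1 -I2 !measure_sections_swap//; apply: eq_integral => y _.
rewrite -[LHS](lebesgue_colvec_translate (invmx M *m y)); last first.
  by rewrite (_ : [set _ | _] = ysection E1 y); [exact: measurable_ysection|
    apply/funext => x; rewrite /ysection; apply/propext; split; rewrite /= inE].
  apply: (congr1 mu); apply/funext => x; rewrite /E1 /E2 /=.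
  by rewrite mulmxBr mulKVmx// scale1r scaleN1r subrK.
Qed.

(** The formula above for the identity matrix, the unit cube having measure 1. *)
Lemma lebesgue_colvecN E : measurable E -> mu (-%R @^-1` E) = mu E.
Proof.
move=> mE; have := @mulmx_preimage_proportional 1%:M E (unitmx1 _ _) mE.
rewrite (_ : (fun x : 'cV[R]_n => 1%:M *m x) = id); last first.
  by apply/funext => x; rewrite mul1mx.
by rewrite !preimage_id lebesgue_unit_cube mul1e.
Qed.

(** For an invertible M, this is the inverse of the absolute value of its
    determinant. *)
Definition modulus M : R := fine (mu ((fun x => M *m x) @^-1` unit_cube)).

Lemma bounded_mulmx_preimage M E (r : R) : M \in unitmx ->
  (forall x, E x -> forall i, `|x i ord0| <= r) ->
  exists r', forall x, ((fun x => M *m x) @^-1` E) x -> forall i, `|x i ord0| <= r'.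
Proof.
move=> uM Er; exists (\sum_i \sum_j `|invmx M i j| * `|r|) => x Ex i.
rewrite -[x](mulKmx uM) mxE (le_trans (ler_norm_sum _ _ _))//.
rewrite [leRHS](bigD1 i)//= -[leLHS]addr0 lerD//.
  apply: ler_sum => j _; rewrite normrM ler_wpM2l//.
  by rewrite (le_trans (Er _ Ex j))// ler_norm.
by apply: sumr_ge0 => k _; apply: sumr_ge0 => j _; rewrite mulr_ge0.
Qed.

Lemma mulmx_preimageE M E : M \in unitmx -> measurable E ->
  mu ((fun x => M *m x) @^-1` E) = ((modulus M)%:E * mu E)%E.
Proof.
move=> uM mE; rewrite mulmx_preimage_proportional// lebesgue_colvecN//.
rewrite fineK// ge0_fin_numE//.
have [|r' r'P] := @bounded_mulmx_preimage M unit_cube 1 uM.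
  by move=> x xQ i; have /andP[x0 /ltW x1] := xQ i; rewrite ger0_norm.
apply: lebesgue_colvec_bounded r'P.
by apply: preimage_measurable; [exact: measurable_mulmx|exact: measurable_box].
Qed.

Lemma modulus_ge0 M : 0 <= modulus M.
Proof. exact: fine_ge0. Qed.

Lemma modulus_invmx M : M \in unitmx -> modulus M * modulus (invmx M) = 1.
Proof.
move=> uM; apply: EFin_inj; rewrite EFinM.
have uM' : invmx M \in unitmx by rewrite unitmx_inv.
have := mulmx_preimageE uM' (@measurable_box R n 0 1).
rewrite lebesgue_unit_cube mule1 => <-; rewrite -mulmx_preimageE//; last first.
  by apply: preimage_measurable; [exact: measurable_mulmx|exact: measurable_box].
rewrite -lebesgue_unit_cube; apply: (congr1 mu); apply/funext => x /=.
by rewrite mulKmx.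
Qed.

Lemma modulus_gt0 M : M \in unitmx -> 0 < modulus M.
Proof.
move=> uM; rewrite lt_neqAle modulus_ge0 andbT; apply/eqP => M0.
by have := modulus_invmx uM; rewrite -M0 mul0r => /eqP; rewrite eq_sym oner_eq0.
Qed.

Lemma ge0_integral_mulmx M (f : 'cV[R]_n -> \bar R) : M \in unitmx ->
  measurable_fun setT f -> (forall x, 0 <= f x)%E ->
  (\int[mu]_x f (M *m x) = (modulus M)%:E * \int[mu]_x f x)%E.
Proof.
move=> uM mf f0; apply: ge0_integral_scaled => //.
- exact: measurable_mulmx.
- exact: modulus_ge0.
- by move=> E mE; exact: mulmx_preimageE.
Qed.

Lemma ge0_integral_translate (a : 'cV[R]_n) (f : 'cV[R]_n -> \bar R) :
  measurable_fun setT f -> (forall x, 0 <= f x)%E ->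
  (\int[mu]_x f (x - a)%R = \int[mu]_x f x)%E.
Proof.
move=> mf f0; rewrite (ge0_integral_scaled (c := 1)) ?mul1e//.
- exact: measurable_colvec_translate.
- by move=> E mE; rewrite mul1e; exact: lebesgue_colvec_translate.
Qed.

End haar.

(** * Packings and coverings by integer translates *)

Section countable_unions.
Context d (T : measurableType d) (R : realType) (mu : {measure set T -> \bar R}).
Variable K : countType.
Implicit Types F : K -> set T.

(** Indexing by codes makes the countable additivity of measures, which is
    about sequences, available for families indexed by integer vectors. *)
Definition nat_family F (i : nat) : set T := oapp F set0 (pickle_inv i).

Lemma bigcup_nat_family F : \bigcup_i nat_family F i = \bigcup_k F k.
Proof.
apply/seteqP; split=> [x [i _]|x [k _ Fx]]; rewrite /nat_family.
  by case: pickle_inv => //= k Fx; exists k.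
by exists (pickle k) => //; rewrite /nat_family pickleK_inv.
Qed.

Lemma measurable_nat_family F :
  (forall k, measurable (F k)) -> forall i, measurable (nat_family F i).
Proof. by move=> mF i; rewrite /nat_family; case: pickle_inv => /=. Qed.

Lemma measurable_countbigcup F :
  (forall k, measurable (F k)) -> measurable (\bigcup_k F k).
Proof.
move=> mF; rewrite -bigcup_nat_family; apply: bigcupT_measurable.
exact: measurable_nat_family.
Qed.

Lemma measure_countbigcup0 F :
  (forall k, measurable (F k)) -> (forall k, mu (F k) = 0%E) ->
  mu (\bigcup_k F k) = 0%E.
Proof.
move=> mF F0; apply/eqP; rewrite eq_le measure_ge0 andbT.
rewrite -bigcup_nat_family.
have := @measure_sigma_subadditive _ _ _ mu (\bigcup_i nat_family F i) (nat_family F)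
  (measurable_nat_family mF) _ (@subset_refl _ _).
rewrite eseries0 => [|i _ _]; first by apply; apply: bigcupT_measurable; exact: measurable_nat_family.
by rewrite /nat_family; case: pickle_inv => /=.
Qed.
End countable_unions.

Section lattice.
Context (R : realType) (n : nat).
Local Notation mu := (lebesgue_colvec R n).
Local Notation Z := (@intmx R n 1).
Implicit Types (P Q : set 'cV[R]_n) (k l : 'cV[int]_n).

Lemma intmxE m p (M : 'M[int]_(m, p)) i j : intmx R M i j = (M i j)%:~R.
Proof. by rewrite mxE. Qed.

Lemma intmxD m p (M N : 'M[int]_(m, p)) : intmx R (M + N) = intmx R M + intmx R N.
Proof. exact: map_mxD. Qed.

Lemma intmxB m p (M N : 'M[int]_(m, p)) : intmx R (M - N) = intmx R M - intmx R N.
Proof. exact: map_mxB. Qed.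

Lemma intmx0 m p : intmx R (0 : 'M[int]_(m, p)) = 0.
Proof. exact: map_mx0. Qed.

Lemma intmxM m p q (M : 'M[int]_(m, p)) (N : 'M[int]_(p, q)) :
  intmx R (M *m N) = intmx R M *m intmx R N.
Proof. exact: map_mxM. Qed.

Lemma intmx_inj m p : injective (@intmx R m p).
Proof. move=> M N /matrixP MN; apply/matrixP => i j; apply/eqP.
by rewrite -(eqr_int R) -!intmxE MN. Qed.

Definition shift k P : set 'cV[R]_n := (fun x => x - Z k) @^-1` P.

Lemma measurable_shift k P : measurable P -> measurable (shift k P).
Proof. by move=> mP; apply: preimage_measurable => //; exact: measurable_colvec_translate. Qed.

Lemma lebesgue_shift k P : measurable P -> mu (shift k P) = mu P.
Proof. exact: lebesgue_colvec_translate. Qed.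

Definition covers P := forall x, exists k, shift k P x.
Definition packs P := forall k l x, shift k P x -> shift l P x -> k = l.
Definition ae_packs P := forall k l, k != l -> mu (shift k P `&` shift l P) = 0%E.

(** Cut P along the translates of Q and move every piece back into Q: the
    pieces stay disjoint because P packs. *)
Lemma packs_le_covers P Q : measurable P -> measurable Q ->
  packs P -> covers Q -> (mu P <= mu Q)%E.
Proof.
move=> mP mQ pP cQ.
pose F k := P `&` shift k Q; pose G k := shift (- k) P `&` Q.
have mF k : measurable (F k) by apply: measurableI => //; exact: measurable_shift.
have mG k : measurable (G k) by apply: measurableI => //; exact: measurable_shift.
have FG k : mu (F k) = mu (G k).
  rewrite -[LHS](lebesgue_shift (- k))//; apply: (congr1 mu).
  apply/seteqP; split=> x; rewrite /F /G /shift /= /intmx map_mxN opprK addrK//.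
rewrite (_ : P = \bigcup_i nat_family F i); last first.
  rewrite bigcup_nat_family; apply/seteqP; split=> [x Px|x [k _ []]//].
  by have [k kx] := cQ x; exists k.
apply: (@le_trans _ _ (\sum_(i <oo) mu (nat_family F i))%E).
  apply: measure_sigma_subadditive => //; first exact: measurable_nat_family.
  by apply: bigcupT_measurable; exact: measurable_nat_family.
rewrite (eq_eseriesr (g := fun i => mu (nat_family G i))); last first.
  by move=> i _; rewrite /nat_family; case: pickle_inv => [k|] /=; rewrite ?measure0.
have tG : trivIset setT (nat_family G).
  move=> i j _ _ [x []]; rewrite /nat_family.
  have := @pickle_invK 'cV[int]_n i; have := @pickle_invK 'cV[int]_n j.
  case: pickle_inv => // k <-; case: pickle_inv => //= l <- [Gk _] [Gl _].
  apply: (congr1 pickle); apply: oppr_inj; exact: pP Gk Gl.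
have := @measure_semi_bigcup _ _ _ mu (nat_family G) (measurable_nat_family mG) tG.
rewrite bigcup_nat_family => <-; last exact: measurable_countbigcup.
apply: le_measure; rewrite ?inE//; first exact: measurable_countbigcup.
by move=> x [k _ []].
Qed.

(** Removing from P its overlaps with its own translates costs no measure and
    leaves a set whose translates are disjoint. *)
Lemma ae_packs_le_covers P Q : measurable P -> measurable Q ->
  ae_packs P -> covers Q -> (mu P <= mu Q)%E.
Proof.
move=> mP mQ pP cQ.
pose N := \bigcup_k (if k == 0 then set0 else P `&` shift k P).
have mN : measurable N.
  apply: measurable_countbigcup => k; case: eqP => // _.
  by apply: measurableI => //; exact: measurable_shift.
have N0 : mu N = 0%E.
  apply: measure_countbigcup0 => k; case: (eqVneq k 0) => [_|k0]; rewrite ?measure0//.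
  - by apply: measurableI => //; exact: measurable_shift.
  - have := pP 0 k; rewrite eq_sym k0 (_ : shift 0 P = P) => [H|]; first exact: H.
    by apply/funext => x; rewrite /shift/= intmx0 subr0.
have -> : mu P = mu (P `\` N).
  apply/eqP; rewrite eq_le; apply/andP; split; last first.
    by apply: le_measure; rewrite ?inE; [exact: measurableD|exact: mP|exact: subDsetl].
  rewrite -[leRHS]adde0 -N0.
  apply: le_trans (measureU2 _ _ _) => //; last exact: measurableD.
  apply: le_measure; rewrite ?inE//.
    by apply: measurableU => //; exact: measurableD.
  by move=> x Px; have [Nx|Nx] := pselect (N x); [right|left].
apply: packs_le_covers => //; first exact: measurableD.
move=> k l x [Pk Nk] [Pl Nl]; apply: contrapT => kl; apply: Nl.
exists (k - l) => //; rewrite subr_eq0 ifF; last exact/eqP.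
by split => //; rewrite /shift /= intmxB opprB -addrA addKr.
Qed.

Lemma unit_cube_covers : covers (@unit_cube R n).
Proof.
move=> x; exists (\col_i Num.floor (x i ord0)) => i; rewrite !mxE.
by rewrite subr_ge0 floor_le_tmp/= ltrBlDl -intrD1 floorD1_gt.
Qed.

Lemma unit_cube_packs : packs (@unit_cube R n).
Proof.
move=> k l x kx lx; apply/colP => i.
have := kx i; have := lx i; rewrite !mxE => /andP[l0 l1] /andP[k0 k1].
have H (a b : int) (t : R) : 0 <= t - a%:~R -> t - b%:~R < 1 -> a <= b.
  move=> ha hb; rewrite -ltzD1 -(ltr_int R) intrD; lra.
by apply/eqP; rewrite eq_le (H _ _ _ k0 l1) (H _ _ _ l0 k1).
Qed.

Lemma measurable_unit_cube : measurable (@unit_cube R n).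
Proof. exact: measurable_box. Qed.

Lemma covers_measure_ge1 P : measurable P -> covers P -> (1 <= mu P)%E.
Proof.
move=> mP cP; rewrite -(lebesgue_unit_cube R n).
exact: packs_le_covers measurable_unit_cube mP unit_cube_packs cP.
Qed.

Lemma ae_packs_measure_le1 P : measurable P -> ae_packs P -> (mu P <= 1)%E.
Proof.
move=> mP pP; rewrite -(lebesgue_unit_cube R n).
exact: ae_packs_le_covers mP measurable_unit_cube pP unit_cube_covers.
Qed.

Lemma packs_ae P : packs P -> ae_packs P.
Proof.
move=> pP k l kl; rewrite [X in mu X](_ : _ = set0) ?measure0//.
by apply/seteqP; split=> // x [] /pP /[apply] /eqP; rewrite (negbTE kl).
Qed.

Lemma finite_bounded_intcol (m : nat) :
  finite_set [set k : 'cV[int]_n | forall i, (absz (k i ord0) <= m)%N].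
Proof.
pose f (k : 'cV[int]_n) : {ffun 'I_n -> 'I_(m + m).+1} :=
  [ffun i => inord (absz (k i ord0 + m%:Z))].
have fI : {in [set k : 'cV[int]_n | forall i, (absz (k i ord0) <= m)%N] &, injective f}.
  move=> k l /[!inE] /= km lm /ffunP kl; apply/colP => i.
  have := congr1 val (kl i); rewrite !ffunE /= !inordK; have := km i; have := lm i; move: (k i ord0) (l i ord0) => a b; lia.
rewrite -(eq_finite_set (inj_card_eq fI)); exact: finite_finset.
Qed.

Lemma finite_bounded_lattice (r : R) :
  finite_set [set k : 'cV[int]_n | forall i, `|Z k i ord0| <= r].
Proof.
apply: sub_finite_set (finite_bounded_intcol (Num.bound `|r|)) => k /= kr i.
have := kr i; rewrite intmxE -intr_norm -abszE => ki.
rewrite -(ler_nat R) pmulrn (le_trans ki)// (le_trans (ler_norm r))//.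
by rewrite ltW// archi_boundP.
Qed.

End lattice.

(** * Volume and decay of powers of a matrix *)

Section modulus_theory.
Context (R : realType) (n : nat).
Local Notation mu := (lebesgue_colvec R n).
Implicit Types M N : 'M[R]_n.

Lemma modulusM M N : M \in unitmx -> N \in unitmx ->
  modulus (M *m N) = modulus M * modulus N.
Proof.
move=> uM uN; apply: EFin_inj; have mQ := @measurable_unit_cube R n.
have uMN : M *m N \in unitmx by rewrite unitmx_mul uM.
rewrite EFinM [RHS]muleC -[LHS]mule1 -[X in (_ = _ * X)%E]mule1 -(lebesgue_unit_cube R n).
transitivity (mu ((fun x => M *m N *m x) @^-1` @unit_cube R n)).
  by apply/esym; exact: mulmx_preimageE.
have -> : ((fun x => M *m N *m x) @^-1` @unit_cube R n) =
    (fun x => N *m x) @^-1` ((fun x => M *m x) @^-1` @unit_cube R n).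
  by apply/funext => x /=; rewrite mulmxA.
rewrite [LHS]mulmx_preimageE//; last first.
  by apply: preimage_measurable => //; exact: measurable_mulmx.
by congr (_ * _)%E; exact: mulmx_preimageE.
Qed.

Lemma modulus1 : modulus (1%:M : 'M[R]_n) = 1.
Proof.
apply: EFin_inj; rewrite -[LHS]mule1 -(lebesgue_unit_cube R n).
transitivity (mu ((fun x => 1%:M *m x) @^-1` @unit_cube R n)).
  apply/esym; apply: mulmx_preimageE; first exact: unitmx1.
  exact: measurable_unit_cube.
by apply: (congr1 mu); apply/funext => x /=; rewrite mul1mx.
Qed.

Lemma unitmxX M j : M \in unitmx -> M ^+ j \in unitmx.
Proof.
move=> uM; elim: j => [|j IHj]; first by rewrite expr0 unitmx1.
by rewrite exprS unitmx_mul uM.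
Qed.

Lemma modulusX M j : M \in unitmx -> modulus (M ^+ j) = modulus M ^+ j.
Proof.
move=> uM; elim: j => [|j IHj]; first by rewrite !expr0 modulus1.
by rewrite !exprS [LHS]modulusM ?IHj// unitmxX.
Qed.

Lemma invmx_expK M j (x : 'cV[R]_n) : M \in unitmx ->
  invmx M ^+ j *m (M ^+ j *m x) = x.
Proof.
move=> uM; elim: j => [|j IHj]; first by rewrite !expr0 !mul1mx.
by rewrite exprSr exprS -mulmxA (mulmxA (invmx M)) mulKmx.
Qed.
End modulus_theory.


Section contraction.
Context (C : numClosedFieldType).

(** Decay is asked of the entries, which avoids a choice of matrix norm, and
    on a right factor W, to which the factors of the characteristic polynomial
    of B are moved one after the other. *)
Definition geom_decay n m (B : 'M[C]_n) (s : C) (W : 'M[C]_(n, m)) :=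
  exists2 K : C, 0 <= K & forall j a b, `|(B ^+ j *m W) a b| <= K * s ^+ j.

(** The matrices B^j W satisfy a first-order recurrence with ratio lam and a
    right-hand side of order s^j, and the ratio is smaller than s. *)
Lemma geom_decay_subl n m (B : 'M[C]_n) (s rho lam : C) (W : 'M[C]_(n, m)) :
  `|lam| <= rho -> 0 <= rho -> rho < s ->
  geom_decay B s ((B - lam%:M) *m W) -> geom_decay B s W.
Proof.
move=> lrho rho0 rhos [K K0 KP].
(* The first term bounds W, the second is the equilibrium of the recurrence. *)
pose K' := (\sum_a \sum_b `|W a b|) + K / (s - rho).
have sr : 0 < s - rho by rewrite subr_gt0.
have s0 : 0 < s by exact: le_lt_trans rhos.
have Ksr : 0 <= K / (s - rho) by rewrite divr_ge0// ltW.
have K'0 : 0 <= K'.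
  by apply: addr_ge0 => //; apply: sumr_ge0 => a _; apply: sumr_ge0.
exists K' => // j a b; elim: j => [|j IHj].
  rewrite expr0 mulr1 mul1mx /K' (bigD1 a)//= (bigD1 b)//= -!addrA lerDl.
  apply: addr_ge0; first exact: sumr_ge0.
  by apply: addr_ge0 => //; apply: sumr_ge0 => k _; apply: sumr_ge0.
have -> : B ^+ j.+1 *m W = lam *: (B ^+ j *m W) + B ^+ j *m ((B - lam%:M) *m W).
  by rewrite mulmxBl mulmxBr mul_scalar_mx -scalemxAr addrC subrK mulmxA exprSr.
rewrite mxE mxE (le_trans (ler_normD _ _))//.
have {}KP := KP j a b.
apply: (@le_trans _ _ (rho * (K' * s ^+ j) + K * s ^+ j)).
  by rewrite lerD// normrM ler_pM.
rewrite (_ : _ + _ = (rho * K' + K) * s ^+ j); last by ring.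
rewrite exprS mulrA ler_wpM2r ?exprn_ge0 ?(ltW s0)//.
rewrite -lerBrDl (_ : _ - _ = (s - rho) * K'); last by ring.
apply: (@le_trans _ _ ((s - rho) * (K / (s - rho)))).
  by rewrite mulrC divfK// gt_eqF.
rewrite ler_wpM2l ?(ltW sr)// /K' lerDr.
by apply: sumr_ge0 => k _; apply: sumr_ge0.
Qed.

Lemma geom_decay_prod n m (B : 'M[C]_n) (s rho : C) (ls : seq C) (W : 'M[C]_(n, m)) :
  0 <= rho -> rho < s -> {in ls, forall l, `|l| <= rho} ->
  geom_decay B s (foldr (fun l V => (B - l%:M) *m V) W ls) -> geom_decay B s W.
Proof.
move=> rho0 rhos; elim: ls W => [//|l ls IHls] W lsP H.
apply: IHls; first by move=> l' l's; apply: lsP; rewrite inE l's orbT.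
by apply: geom_decay_subl rhos H => //; apply: lsP; rewrite inE eqxx.
Qed.

(** By the Cayley-Hamilton theorem the product of the B - l over the
    eigenvalues l is 0, for which decay is trivial; the factors are then
    removed one at a time. *)
Lemma spectral_radius_lt1_decay n (B : 'M[C]_n.+1) :
  (forall l, eigenvalue B l -> `|l| < 1) ->
  exists2 s : C, 0 < s < 1 & geom_decay B s 1%:M.
Proof.
move=> Bl; have [ls lsE] := closed_field_poly_normal (char_poly B).
have lsP : {in ls, forall l, `|l| < 1}.
  move=> l lls; apply: Bl; rewrite eigenvalue_root_char lsE.
  by rewrite (monicP (char_poly_monic B)) scale1r root_prod_XsubC.
have [rho rho0 [rho1 rhoP]] : exists2 rho : C, 0 <= rho & rho < 1 /\ {in ls, forall l, `|l| <= rho}.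
  elim: ls lsP {lsE} => [|l ls IHls] lsP; first by exists 0 => //; split; rewrite ?ltr01.
  have [|rho rho0 [rho1 rhoP]] := IHls.
    by move=> l' l's; apply: lsP; rewrite inE l's orbT.
  have l1 : `|l| < 1 by apply: lsP; rewrite inE eqxx.
  have rr : rho >=< `|l| by rewrite real_comparable// ger0_real.
  exists (Num.max rho `|l|); first by rewrite comparable_le_max ?rho0// real_comparable ?ger0_real.
  split; first by rewrite comparable_gt_max// rho1.
  move=> l'; rewrite inE => /orP[/eqP->|/rhoP H].
    by rewrite comparable_le_max ?lexx ?orbT// real_comparable ?ger0_real.
  by rewrite comparable_le_max ?H// real_comparable ?ger0_real.
exists ((rho + 1) / 2).
  by rewrite midf_lt//= andbT divr_gt0// ltr_wpDl.
apply: (@geom_decay_prod _ _ B _ rho ls); rewrite ?midf_lt//.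
have -> : foldr (fun l V => (B - l%:M) *m V) 1%:M ls = 0.
  transitivity (horner_mx B (\prod_(z <- ls) ('X - z%:P))).
    elim: ls {lsE lsP rhoP} => [|l ls IHls] /=; first by rewrite big_nil [RHS]rmorph1.
    by rewrite big_cons rmorphM rmorphB /= horner_mx_X horner_mx_C IHls.
  have := Cayley_Hamilton B; rewrite lsE (monicP (char_poly_monic B)).
  by rewrite scale1r.
by exists 0 => // j a b; rewrite mulmx0 mxE normr0 mul0r.
Qed.
End contraction.

Section dilation.
Context (R : realType) (n : nat) (A : 'M[int]_n.+1).
Hypothesis dilA : dilation_matrix R A.

Lemma dilation_unitmxC : intmx R[i] A \in unitmx.
Proof.
rewrite unitmxE unitfE; apply/eqP => /eqP/det0P[v v0 vA].
have /dilA : eigenvalue (intmx R[i] A) 0.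
  by apply/eigenvalueP; exists v => //; rewrite vA scale0r.
by rewrite normr0 ltr10.
Qed.

Lemma dilation_unitmx : intmx R A \in unitmx.
Proof.
have := dilation_unitmxC.
rewrite -(_ : map_mx (real_complex R) (intmx R A) = intmx R[i] A); last first.
  by apply/matrixP => i j; rewrite !mxE rmorph_int.
by rewrite map_unitmx.
Qed.

(** The eigenvalues of the inverse of A are the inverses of those of A. *)
Lemma dilation_decay : exists s K : R, [/\ 0 < s, s < 1, 0 < K &
  forall j a b, `|(invmx (intmx R A) ^+ j) a b| <= K * s ^+ j].
Proof.
have [|s /andP[s0 s1] [K K0 KP]] := @spectral_radius_lt1_decay R[i] n (invmx (intmx R[i] A)).
  move=> l /eigenvalueP[v vB v0].
  have l0 : l != 0.
    apply: contraNneq v0 => l0; move: vB; rewrite l0 scale0r => /(congr1 (mulmx^~ (intmx R[i] A))).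
    by rewrite mulmxKV ?dilation_unitmxC// mul0mx => ->.
  rewrite -[l]invrK normfV invf_lt1 ?normr_gt0 ?invr_eq0//.
  apply: dilA; apply/eigenvalueP; exists v => //.
  have := congr1 (mulmx^~ (intmx R[i] A)) vB.
  rewrite /= mulmxKV ?dilation_unitmxC// -scalemxAl => {2}->.
  by rewrite scalerA mulVf// scale1r.
have [s' sE] : exists s', s = real_complex R s'.
  by exists (complex.Re s); rewrite RRe_real// ger0_real ?ltW.
have [K' KE] : exists K', K = real_complex R K'.
  by exists (complex.Re K); rewrite RRe_real// ger0_real.
subst s K; move: s0 s1 K0; rewrite !ltcR lecR => s0 s1 K0.
exists s', (K' + 1); split => //; first by rewrite ltr_wpDl.
move=> j a b; apply: (@le_trans _ _ (K' * s' ^+ j)); last first.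
  by rewrite ler_wpM2r ?exprn_ge0 ?lerDl// ltW.
rewrite -lecR; have := KP j a b; rewrite mulmx1 -rmorphXn -rmorphM /=.
rewrite -(_ : map_mx (real_complex R) (invmx (intmx R A) ^+ j) = invmx (intmx R[i] A) ^+ j).
  by rewrite mxE normc_def /= expr0n/= addr0 sqrtr_sqr.
rewrite rmorphXn /= map_invmx; congr (invmx _ ^+ _).
by apply/matrixP => i k; rewrite !mxE rmorph_int.
Qed.

End dilation.

(** A high power of the inverse of M maps the unit cube into a box of volume
    less than 1. *)
Lemma modulus_lt1 (R : realType) n (M : 'M[R]_n.+1) (s K : R) :
  M \in unitmx -> 0 < s -> s < 1 -> 0 < K ->
  (forall j a b, `|(invmx M ^+ j) a b| <= K * s ^+ j) -> modulus M < 1.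
Proof.
move=> uM s0 s1 K0 decay.
have [j js] : exists j, n.+1%:R * K * s ^+ j <= 4^-1.
  have nK : 0 < n.+1%:R * K by rewrite mulr_gt0.
  have sN : s ^+ N @[N --> \oo] --> (0 : R) by apply: cvg_expr; rewrite ger0_norm// ltW.
  have e0 : 0 < 4^-1 / (n.+1%:R * K) by rewrite divr_gt0// invr_gt0.
  have [N _ HN] := cvgr_le _ sN _ e0.
  by exists N; rewrite mulrC -ler_pdivlMr//; exact: (HN N (leqnn N)).
(* The image is within 1/4 of 0; the box [-1/4, 1/2) is half-open, as boxes are. *)
rewrite ltNge; apply/negP => M1.
have : 1 <= modulus (M ^+ j) by rewrite modulusX// exprn_ege1.
apply/negP; rewrite -ltNge; apply: (@le_lt_trans _ _ ((2^-1 - - 4^-1) ^+ n.+1)); last first.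
  by rewrite exprn_ilt1//; lra.
have uMj := unitmxX j uM; have mQ := @measurable_unit_cube R n.+1.
rewrite -lee_fin -lebesgue_colvec_box; last by lra.
rewrite -[leLHS]mule1 -(lebesgue_unit_cube R n.+1) -[leLHS]mulmx_preimageE//.
apply: le_measure; rewrite ?inE.
- by apply: preimage_measurable => //; exact: measurable_mulmx.
- exact: measurable_box.
move=> x /= xQ i.
suff : `|x i ord0| <= 4^-1 by rewrite ler_norml => /andP[? ?]; apply/andP; split; lra.
rewrite -[x](invmx_expK j _ uM) mxE (le_trans (ler_norm_sum _ _ _))//.
apply: le_trans js; rewrite (_ : _ * s ^+ j = \sum_(k < n.+1) K * s ^+ j * 1); last first.
  by rewrite sumr_const card_ord -mulr_natl; ring.
apply: ler_sum => k _; rewrite normrM ler_pM//.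
by have /andP[h0 /ltW h1] := xQ k; rewrite ger0_norm.
Qed.


(** * Square-integrable functions and closed subspaces *)

Section square_norm.
Context (R : realType) (n : nat).
Local Notation mu := (lebesgue_colvec R n).
Implicit Types f g h : 'cV[R]_n -> R[i].
Implicit Types z w : R[i].

(** The squared norm, in the type of the reals, where integrals live. *)
Definition abs2 z : R := complex.Re z ^+ 2 + complex.Im z ^+ 2.

Lemma abs2_ge0 z : 0 <= abs2 z.
Proof. by rewrite addr_ge0// sqr_ge0. Qed.

Lemma abs2M z w : abs2 (z * w) = abs2 z * abs2 w.
Proof. by case: z w => [a b] [c d]; rewrite /abs2 /=; ring. Qed.

Lemma abs2N z : abs2 (- z) = abs2 z.
Proof. by case: z => [a b]; rewrite /abs2 /= !sqrrN. Qed.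

Lemma abs2_0 : abs2 0 = 0.
Proof. by rewrite /abs2 /= expr0n addr0. Qed.

Lemma abs2_1 : abs2 1 = 1.
Proof. by rewrite /abs2 /= expr0n expr1n addr0. Qed.

Lemma abs2_eq0 z : (abs2 z == 0) = (z == 0).
Proof.
case: z => a b; rewrite /abs2 /= paddr_eq0 ?sqr_ge0// !sqrf_eq0.
by rewrite eq_complex.
Qed.

Lemma abs2D z w : abs2 (z + w) <= 2 * abs2 z + 2 * abs2 w.
Proof.
case: z w => [a b] [c d]; rewrite /abs2 /=.
have := sqr_ge0 (a - c); have := sqr_ge0 (b - d); nra.
Qed.

Lemma abs2E z : complex.Re `|z| ^+ 2 = abs2 z.
Proof. by case: z => a b; rewrite normc_def /= sqr_sqrtr// addr_ge0// sqr_ge0. Qed.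

(** The square of the L^2 norm.  Being a plain integral, it makes limits and
    changes of variables immediate; in place of the triangle inequality,
    [sqintD] has a factor 2, harmless in limits. *)
Definition sqint f : \bar R := (\int[mu]_x (abs2 (f x))%:E)%E.

Lemma sqint_ge0 f : (0 <= sqint f)%E.
Proof. by apply: integral_ge0 => x _; rewrite lee_fin abs2_ge0. Qed.

Lemma L2norm_sqr f : (L2norm f `^ 2 = sqint f)%E.
Proof.
rewrite /L2norm poweR_Lnorm//; apply: eq_integral => x _ /=.
by rewrite powR_mulrn ?normr_ge0// real_normK ?num_real// abs2E.
Qed.

Lemma L2norm_lty f : (L2norm f < +oo)%E = (sqint f < +oo)%E.
Proof.
rewrite -L2norm_sqr; have := Lnorm_ge0 mu 2%:E (fun x => (complex.Re `|f x|)%:E).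
by rewrite -/(L2norm f); case: (L2norm f) => [r _|_|//] /=; rewrite ?ltry// pnatr_eq0.
Qed.

Lemma L2norm_lt f (e : R) : 0 < e -> (L2norm f < e%:E)%E = (sqint f < (e ^+ 2)%:E)%E.
Proof.
move=> e0; rewrite -L2norm_sqr.
have := Lnorm_ge0 mu 2%:E (fun x => (complex.Re `|f x|)%:E).
rewrite -/(L2norm f); case: (L2norm f) => [r|_|//] /=; last by rewrite pnatr_eq0 /= !ltNge !leey.
rewrite lee_fin => r0; rewrite !lte_fin powR_mulrn// ltr_pXn2r//= ?nnegrE//.
exact: ltW.
Qed.

Lemma L2P f : L2 f <-> cmeasurable f /\ (sqint f < +oo)%E.
Proof. by rewrite /L2 /= L2norm_lty. Qed.

Lemma L2closureP (S : set ('cV[R]_n -> R[i])) f : L2closure S f <->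
  L2 f /\ forall e : R, 0 < e -> exists2 g, S g & (sqint (fun x => f x - g x)%R < e%:E)%E.
Proof.
split=> [[Lf H]|[Lf H]]; split=> // e e0.
  have [|g Sg] := H (Num.sqrt e); first by rewrite sqrtr_gt0.
  by rewrite L2norm_lt ?sqrtr_gt0// sqr_sqrtr ?ltW//; exists g.
have [|g Sg] := H (e ^+ 2); first by rewrite exprn_gt0.
by exists g => //; rewrite L2norm_lt.
Qed.

Lemma cmeasurable_cst z : cmeasurable (fun _ : 'cV[R]_n => z).
Proof. by split; exact: measurable_cst. Qed.

Lemma cmeasurableD f g : cmeasurable f -> cmeasurable g ->
  cmeasurable (fun x => f x + g x).
Proof.
move=> [rf jf] [rg jg]; split.
  rewrite (_ : (fun _ => _) = (fun x => complex.Re (f x) + complex.Re (g x))).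
    exact: measurable_funD.
  by apply/funext => x; case: (f x) (g x) => [? ?] [].
rewrite (_ : (fun _ => _) = (fun x => complex.Im (f x) + complex.Im (g x))).
  exact: measurable_funD.
by apply/funext => x; case: (f x) (g x) => [? ?] [].
Qed.

Lemma cmeasurableM f g : cmeasurable f -> cmeasurable g ->
  cmeasurable (fun x => f x * g x).
Proof.
move=> [rf jf] [rg jg]; split.
  rewrite (_ : (fun _ => _) = (fun x => complex.Re (f x) * complex.Re (g x)
      - complex.Im (f x) * complex.Im (g x))).
    by apply: measurable_funB; exact: measurable_funM.
  by apply/funext => x; case: (f x) (g x) => [? ?] [].
rewrite (_ : (fun _ => _) = (fun x => complex.Re (f x) * complex.Im (g x)
    + complex.Im (f x) * complex.Re (g x))).
  by apply: measurable_funD; exact: measurable_funM.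
by apply/funext => x; case: (f x) (g x) => [? ?] [].
Qed.

Lemma cmeasurableN f : cmeasurable f -> cmeasurable (fun x => - f x).
Proof.
move=> mf; rewrite (_ : (fun _ => _) = (fun x => (-1) * f x)).
  by apply: cmeasurableM => //; exact: cmeasurable_cst.
by apply/funext => x; rewrite mulN1r.
Qed.

Lemma cmeasurableB f g : cmeasurable f -> cmeasurable g ->
  cmeasurable (fun x => f x - g x).
Proof. by move=> mf mg; apply: cmeasurableD => //; exact: cmeasurableN. Qed.

Lemma cmeasurable_indic (E : set 'cV[R]_n) : measurable E ->
  cmeasurable (fun x => \1_E x : R[i]).
Proof.
move=> mE; split.
  rewrite (_ : (fun _ => _) = \1_E :> ('cV[R]_n -> R)); first exact: measurable_indic.
  by apply/funext => x; rewrite !indicE; case: (x \in E).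
rewrite (_ : (fun _ => _) = cst 0); first exact: measurable_cst.
by apply/funext => x; rewrite !indicE; case: (x \in E).
Qed.

Lemma cmeasurable_comp f (phi : 'cV[R]_n -> 'cV[R]_n) :
  measurable_fun setT phi -> cmeasurable f -> cmeasurable (fun x => f (phi x)).
Proof.
move=> mphi [rf jf]; split.
  exact: (measurableT_comp (f := fun y => complex.Re (f y))).
exact: (measurableT_comp (f := fun y => complex.Im (f y))).
Qed.

Lemma measurable_abs2 f : cmeasurable f -> measurable_fun setT (fun x => abs2 (f x)).
Proof. by move=> [rf jf]; apply: measurable_funD; exact: measurable_funX. Qed.

Lemma emeasurable_abs2 f : cmeasurable f -> measurable_fun setT (fun x => (abs2 (f x))%:E).
Proof. by move=> mf; apply/measurable_EFinP; exact: measurable_abs2. Qed.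

Lemma sqintD f g : cmeasurable f -> cmeasurable g ->
  (sqint (fun x => f x + g x)%R <= 2%:E * sqint f + 2%:E * sqint g)%E.
Proof.
move=> mf mg; rewrite /sqint -!ge0_integralZl//.
all: try exact: emeasurable_abs2.
all: try by move=> x _; rewrite lee_fin abs2_ge0.
all: try by rewrite lee_fin.
rewrite -ge0_integralD//; last 4 first.
- by move=> x _; rewrite -EFinM lee_fin mulr_ge0// abs2_ge0.
- by apply: measurable_funeM; exact: emeasurable_abs2.
- by move=> x _; rewrite -EFinM lee_fin mulr_ge0// abs2_ge0.
- by apply: measurable_funeM; exact: emeasurable_abs2.
apply: ge0_le_integral => //.
- by move=> x _; rewrite lee_fin abs2_ge0.
- by apply: emeasurable_abs2; exact: cmeasurableD.
- by apply: emeasurable_funD; apply: measurable_funeM; exact: emeasurable_abs2.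
- by move=> x _; rewrite -!EFinM -EFinD lee_fin abs2D.
Qed.

Lemma sqintN f : sqint (fun x => - f x) = sqint f.
Proof. by apply: eq_integral => x _; rewrite abs2N. Qed.

Lemma sqintZ z f : cmeasurable f -> sqint (fun x => z * f x) = ((abs2 z)%:E * sqint f)%E.
Proof.
move=> mf; rewrite -ge0_integralZl//.
- by apply: eq_integral => x _; rewrite abs2M EFinM.
- exact: emeasurable_abs2.
- by move=> x _; rewrite lee_fin abs2_ge0.
- by rewrite lee_fin abs2_ge0.
Qed.

Lemma L2D f g : L2 f -> L2 g -> L2 (fun x => f x + g x).
Proof.
move=> /L2P[mf ff] /L2P[mg gf]; apply/L2P; split; first exact: cmeasurableD.
apply: le_lt_trans (sqintD mf mg) _.
by rewrite lte_add_pinfty// lte_mul_pinfty// ge0_fin_numE.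
Qed.

Lemma L2Z z f : L2 f -> L2 (fun x => z * f x).
Proof.
move=> /L2P[mf ff]; apply/L2P; split.
  by apply: cmeasurableM => //; exact: cmeasurable_cst.
by rewrite sqintZ// lte_mul_pinfty// lee_fin abs2_ge0.
Qed.

Lemma L2_0 : L2 (fun _ : 'cV[R]_n => 0 : R[i]).
Proof.
apply/L2P; split; first exact: cmeasurable_cst.
by rewrite /sqint integral0_eq// => x _; rewrite abs2_0.
Qed.

Lemma L2_comp_mulmx (M : 'M[R]_n) f : M \in unitmx -> L2 f -> L2 (fun x => f (M *m x)).
Proof.
move=> uM /L2P[mf ff]; apply/L2P; split.
  by apply: cmeasurable_comp => //; exact: measurable_mulmx.
rewrite /sqint (ge0_integral_mulmx (f := fun x => (abs2 (f x))%:E))//.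
- by rewrite lte_mul_pinfty// lee_fin modulus_ge0.
- exact: emeasurable_abs2.
- by move=> x; rewrite lee_fin abs2_ge0.
Qed.

Lemma sqint_comp_mulmx (M : 'M[R]_n) f : M \in unitmx -> cmeasurable f ->
  sqint (fun x => f (M *m x)) = ((modulus M)%:E * sqint f)%E.
Proof.
move=> uM mf; rewrite /sqint (ge0_integral_mulmx (f := fun x => (abs2 (f x))%:E))//.
- exact: emeasurable_abs2.
- by move=> x; rewrite lee_fin abs2_ge0.
Qed.

Lemma sqint_translate (a : 'cV[R]_n) f : cmeasurable f ->
  sqint (fun x => f (x - a)) = sqint f.
Proof.
move=> mf; rewrite /sqint (ge0_integral_translate a (f := fun x => (abs2 (f x))%:E))//.
- exact: emeasurable_abs2.
- by move=> x; rewrite lee_fin abs2_ge0.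
Qed.

End square_norm.

Section closed_subspaces.
Context (R : realType) (n : nat).
Local Notation mu := (lebesgue_colvec R n).
Implicit Types (f g h : 'cV[R]_n -> R[i]) (V W S : set ('cV[R]_n -> R[i])).

Lemma csub_sum W (I : Type) (s : seq I) (F : I -> 'cV[R]_n -> R[i]) :
  closed_subspace W -> (forall k, W (F k)) ->
  W (fun x => \sum_(k <- s) F k x).
Proof.
move=> cW WF; elim: s => [|k s IHs].
  under eq_fun do rewrite big_nil.
  exact: csub_0 cW.
under eq_fun do rewrite big_cons.
exact: (csub_add cW (WF k) IHs).
Qed.

Lemma csubB W f g : closed_subspace W -> W f -> W g -> W (fun x => f x - g x).
Proof.
move=> cW Wf Wg; rewrite (_ : (fun _ => _) = f \+ (fun x => -1 * g x)).
  by apply: (csub_add cW) => //; exact: csub_scale.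
by apply/funext => x /=; rewrite mulN1r.
Qed.

Lemma closed_subspace_closure S : S `<=` @L2 R n -> S (cst 0) ->
  (forall f g, S f -> S g -> S (fun x => f x + g x)) ->
  (forall z f, S f -> S (fun x => z * f x)) ->
  closed_subspace (L2closure S).
Proof.
move=> SL S0 SD SZ; split.
- by move=> f [].
- apply/L2closureP; split; first exact: L2_0.
  move=> e e0; exists (cst 0) => //; rewrite /sqint integral0_eq ?lte_fin// => x _.
  by rewrite subrr abs2_0.
- move=> f g /L2closureP[Lf Hf] /L2closureP[Lg Hg]; apply/L2closureP; split; first exact: L2D.
  move=> e e0; have e4 : 0 < e / 4 by rewrite divr_gt0.
  have [f' Sf' ff'] := Hf _ e4; have [g' Sg' gg'] := Hg _ e4.
  exists (fun x => f' x + g' x); first exact: SD.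
  have /L2P[mf _] := Lf; have /L2P[mg _] := Lg.
  have /L2P[mf' _] := SL _ Sf'; have /L2P[mg' _] := SL _ Sg'.
  rewrite (_ : (fun x => _) = (fun x => (f x - f' x) + (g x - g' x))); last first.
    by apply/funext => x /=; ring.
  apply: le_lt_trans (sqintD _ _) _; [exact: cmeasurableB|exact: cmeasurableB|].
  rewrite (_ : e = 2 * (e / 4) + 2 * (e / 4)); last by field.
  by rewrite [ltRHS]EFinD lteD// EFinM lte_pmul2l// lte_fin.
- move=> z f /L2closureP[Lf Hf]; apply/L2closureP; split; first exact: L2Z.
  move=> e e0; have ez : 0 < e / (abs2 z + 1) by rewrite divr_gt0// ltr_wpDl// abs2_ge0.
  have [f' Sf' ff'] := Hf _ ez.
  exists (fun x => z * f' x); first exact: SZ.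
  have /L2P[mf _] := Lf; have /L2P[mf' _] := SL _ Sf'.
  under [X in sqint X]eq_fun do rewrite -mulrBr.
  rewrite sqintZ; last exact: cmeasurableB.
  apply: (@le_lt_trans _ _ ((abs2 z + 1)%:E * sqint (fun x => (f x - f' x)%R))%E).
    by rewrite lee_wpmul2r ?sqint_ge0// lee_fin lerDl.
  rewrite -lte_pdivlMl ?ltr_wpDl ?abs2_ge0//.
  by rewrite -EFinM mulrC.
- move=> f /L2closureP[Lf Hf]; apply/L2closureP; split=> // e e0.
  have e4 : 0 < e / 4 by rewrite divr_gt0.
  have [g /L2closureP[Lg Hg] fg] := Hf _ e4; have [h Sh gh] := Hg _ e4.
  exists h => //.
  have /L2P[mf _] := Lf; have /L2P[mg _] := Lg; have /L2P[mh _] := SL _ Sh.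
  rewrite (_ : (fun x => _) = (fun x => (f x - g x) + (g x - h x))); last first.
    by apply/funext => x /=; ring.
  apply: le_lt_trans (sqintD _ _) _; [exact: cmeasurableB|exact: cmeasurableB|].
  rewrite (_ : e = 2 * (e / 4) + 2 * (e / 4)); last by field.
  by rewrite [ltRHS]EFinD lteD// EFinM lte_pmul2l// lte_fin.
Qed.

Lemma sub_L2closure S : S `<=` @L2 R n -> S `<=` L2closure S.
Proof.
move=> SL f Sf; apply/L2closureP; split; first exact: SL.
move=> e e0; exists f => //; rewrite /sqint integral0_eq ?lte_fin// => x _.
by rewrite subrr abs2_0.
Qed.

(** Dominated convergence for the squared errors |f - u_m|^2. *)
Lemma csub_dominated W (u : nat -> 'cV[R]_n -> R[i]) f (h : 'cV[R]_n -> R) :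
  closed_subspace W -> (forall m, W (u m)) -> cmeasurable f ->
  measurable_fun setT h -> (forall x, 0 <= h x) ->
  (\int[mu]_x (h x)%:E < +oo)%E ->
  {ae mu, forall x, forall m, abs2 (f x - u m x) <= h x} ->
  {ae mu, forall x, (fun m => abs2 (f x - u m x)) @ \oo --> 0} -> W f.
Proof.
move=> cW Wu mf mh h0 hoo fuh fu.
have mu_ m : cmeasurable (u m) by have /L2P[] := csub_L2 cW (Wu m).
have [] := @dominated_convergence _ _ R mu setT measurableT
   (fun m x => (abs2 (f x - u m x))%:E) (cst 0%E) (EFin \o h) .
- by move=> m; apply: emeasurable_abs2; exact: cmeasurableB.
- exact: measurable_cst.
- by apply: filterS fu => x fux _; apply: cvg_EFin; [exact: nearW|exact: fux].
- apply/integrableP; split; first exact/measurable_EFinP.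
  by under eq_integral do rewrite gee0_abs ?lee_fin//.
- apply: filterS fuh => x fuhx m _.
  by rewrite gee0_abs ?lee_fin ?abs2_ge0.
move=> _ _; rewrite integral_cst// mul0e => cv.
apply: (csub_closed cW); apply/L2closureP.
have H (e : R) : 0 < e -> exists2 g, W g & (sqint (fun x => (f x - g x)%R) < e%:E)%E.
  move=> e0; have [N _ HN] := cv _ (@nbhs_open_ereal_lt _ 0 (cst e) e0).
  by exists (u N) => //; exact: HN (leqnn N).
split=> //; have [g Wg fg] := H 1 ltr01.
rewrite (_ : f = (fun x => (f x - g x) + g x)); last by apply/funext => x; rewrite subrK.
apply: L2D; last exact: csub_L2 Wg.
have /L2P[mg _] := csub_L2 cW Wg.
apply/L2P; split; first exact: cmeasurableB.
exact: lt_trans fg (ltry _).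
Qed.

(** A constant sequence converges almost everywhere to each function that is
    almost everywhere equal to it. *)
Lemma csub_ae W f g : closed_subspace W -> W f -> cmeasurable g ->
  {ae mu, forall x, g x = f x} -> W g.
Proof.
move=> cW Wf mg gf; apply: (@csub_dominated _ (fun=> f) g (cst 0)) => //.
- by rewrite integral0.
- by apply: filterS gf => x -> m; rewrite subrr abs2_0.
- by apply: filterS gf => x ->; rewrite subrr abs2_0; exact: cvg_cst.
Qed.

End closed_subspaces.

Section linear_span.
Context (R : realType) (n : nat) (I : eqType) (e : I -> 'cV[R]_n -> R[i]).

(** Two linear combinations over lists with repetitions can be added once they
    are written over a common list without repetitions. *)
Lemma sum_count_mem (V : zmodType) (F : I -> V) (s t : seq I) :
  uniq t -> {subset s <= t} -> \sum_(k <- s) F k = \sum_(k <- t) F k *+ count_mem k s.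
Proof.
move=> ut; elim: s => [|i s IHs] st.
  by rewrite big_nil big1// => k _; rewrite mulr0n.
rewrite big_cons IHs => [|k ks]; last by apply: st; rewrite inE ks orbT.
under [RHS]eq_bigr do rewrite /= mulrnDr.
rewrite big_split /=; congr (_ + _).
rewrite (bigD1_seq i)//=; last by apply: st; rewrite inE eqxx.
rewrite eqxx mulr1n big1 ?addr0// => k ki.
by rewrite eq_sym (negbTE ki) mulr0n.
Qed.

Lemma lin_span0 : lin_span e (cst 0).
Proof. by exists [::], (fun=> 0); apply/funext => x; rewrite big_nil. Qed.

Lemma lin_spanD f g : lin_span e f -> lin_span e g -> lin_span e (fun x => f x + g x).
Proof.
move=> [s1 [c1 ->]] [s2 [c2 ->]]; exists (undup (s1 ++ s2)).
exists (fun k => c1 k *+ count_mem k s1 + c2 k *+ count_mem k s2).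
apply/funext => x.
rewrite (@sum_count_mem _ _ s1 (undup (s1 ++ s2))) ?undup_uniq//; last first.
  by move=> k ks; rewrite mem_undup mem_cat ks.
rewrite (@sum_count_mem _ _ s2 (undup (s1 ++ s2))) ?undup_uniq//; last first.
  by move=> k ks; rewrite mem_undup mem_cat ks orbT.
by rewrite -big_split; apply: eq_bigr => k _; rewrite mulrDl !mulrnAl.
Qed.

Lemma lin_spanZ z f : lin_span e f -> lin_span e (fun x => z * f x).
Proof.
move=> [s [c ->]]; exists s, (fun k => z * c k); apply/funext => x.
by rewrite mulr_sumr; apply: eq_bigr => k _; rewrite mulrA.
Qed.

Lemma lin_span_mem k : lin_span e (e k).
Proof.
by exists [:: k], (fun=> 1); apply/funext => x; rewrite big_seq1 mul1r.
Qed.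

Lemma lin_span_L2 : (forall k, L2 (e k)) -> lin_span e `<=` @L2 R n.
Proof.
move=> eL _ [s [c ->]]; elim: s => [|k s IHs].
  under eq_fun do rewrite big_nil.
  exact: L2_0.
under eq_fun do rewrite big_cons.
by apply: L2D => //; exact: L2Z.
Qed.

Lemma closed_subspace_span : (forall k, L2 (e k)) ->
  closed_subspace (L2closure (lin_span e)).
Proof.
move=> eL; apply: closed_subspace_closure.
- exact: lin_span_L2.
- exact: lin_span0.
- exact: lin_spanD.
- exact: lin_spanZ.
Qed.

Lemma closed_span_sub W : closed_subspace W -> (forall k, W (e k)) ->
  L2closure (lin_span e) `<=` W.
Proof.
move=> cW We f /L2closureP[Lf Hf]; apply: (csub_closed cW); apply/L2closureP.
split=> // eps eps0; have [g [s [c gE]] fg] := Hf _ eps0; exists g => //.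
by rewrite gE; apply: csub_sum => // k; exact: (csub_scale cW).
Qed.

End linear_span.

Lemma csub_comp (R : realType) n (M : 'M[R]_n) W : M \in unitmx -> closed_subspace W ->
  closed_subspace [set f : 'cV[R]_n -> R[i] | W (fun x => f (M *m x))].
Proof.
move=> uM cW; have L2M f : W (fun x => f (M *m x)) -> L2 f.
  move=> /(csub_L2 cW) Lf; rewrite (_ : f = fun x => f (M *m (invmx M *m x))).
    by apply: (L2_comp_mulmx (M := invmx M) _ Lf); rewrite unitmx_inv.
  by apply/funext => x; rewrite mulKVmx.
split=> /=.
- by move=> f; exact: L2M.
- exact: csub_0 cW.
- by move=> f g Wf Wg; exact: (csub_add cW Wf Wg).
- by move=> a f Wf; exact: (csub_scale cW a Wf).
- move=> f /L2closureP[Lf Hf]; apply: (csub_closed cW); apply/L2closureP.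
  split; first exact: L2_comp_mulmx.
  move=> e e0; have [|g Wg fg] := Hf (e / modulus M).
    by rewrite divr_gt0// modulus_gt0.
  exists (fun x => g (M *m x)) => //.
  have /L2P[mf _] := Lf; have /L2P[mg _] := L2M _ Wg.
  rewrite (sqint_comp_mulmx (f := fun x => f x - g x))//; last exact: cmeasurableB.
  by rewrite -lte_pdivlMl ?modulus_gt0// -EFinM mulrC.
Qed.

(** * A criterion for a closed subspace to be all of L^2 *)

Section density.
Context (R : realType) (n : nat).
Local Notation mu := (lebesgue_colvec R n).
Implicit Types (f g h : 'cV[R]_n -> R[i]) (E O : set 'cV[R]_n).

Definition cindic E : 'cV[R]_n -> R[i] := fun x => \1_E x.

Definition open_box (r : R) : set 'cV[R]_n := [set x | forall i, `|x i ord0| < r].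

Lemma open_coor (i : 'I_n) (C : set R) : open C ->
  open ((fun x : 'cV[R]_n => x i ord0) @^-1` C).
Proof. by move=> oC; apply: open_comp => // x _; exact: coord_continuous. Qed.

Lemma open_boxE r : open_box r =
  \bigcap_(i in [set: 'I_n]) ((fun x : 'cV[R]_n => x i ord0) @^-1` [set t | `|t| < r]).
Proof. by apply/seteqP; split=> x /= H i => [_|]; exact: H. Qed.

Lemma norm_lt_itv (r : R) : [set t : R | `|t| < r] = `]-r, r[%classic.
Proof. by apply/seteqP; split=> t /=; rewrite in_itv /= ltr_norml. Qed.

Lemma open_open_box r : open (open_box r).
Proof.
rewrite openE => x xr.
apply: (@filter_forall _ _ (fun i (y : 'cV[R]_n) => `|y i ord0| < r) (nbhs x) _) => i.
apply: open_nbhs_nbhs; split; last exact: xr.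
by apply: (@open_coor i [set t | `|t| < r]); rewrite norm_lt_itv; exact: interval_open.
Qed.

Lemma measurable_open_box r : measurable (open_box r).
Proof.
rewrite open_boxE; apply: fin_bigcap_measurable => // i _.
apply: preimage_measurable; first exact: measurable_coor.
by rewrite norm_lt_itv; exact: measurable_itv.
Qed.

Lemma lebesgue_open_box_lty r : (mu (open_box r) < +oo)%E.
Proof.
apply: (@lebesgue_colvec_bounded _ _ _ r); first exact: measurable_open_box.
by move=> x xr i; exact: ltW.
Qed.

(** Coordinates are continuous, and open rays generate the Borel sets of the
    line. *)
Lemma measurable_sub_gen_open :
  measurable `<=` <<s [set O : set 'cV[R]_n | open O /\ measurable O] >>.
Proof.
set G := [set O | _]; apply: smallest_sub; first exact: smallest_sigma_algebra.
rewrite -bigcup_seq => _ [i _ [C mC <-]] /=; rewrite setTI.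
pose coor (x : 'cV[R]_n) := x i ord0.
suff : measurable `<=` [set C : set R | <<s G >> (coor @^-1` C)] by apply.
have -> : (measurable : set (set R)) = <<s @RGenOInfty.G R >> by exact: RGenOInfty.measurableE.
have [s0 sC sU] := smallest_sigma_algebra setT G.
apply: smallest_sub.
  split=> /=; first by rewrite preimage_set0.
  - by move=> B sB; rewrite setTD preimage_setC -setTD; exact: sC.
  - by move=> F sF; rewrite preimage_bigcup; exact: sU.
move=> _ [a ->] /=; apply: sub_sigma_algebra; split.
  exact: open_coor.
by apply: preimage_measurable; [exact: measurable_coor|exact: measurable_itv].
Qed.

Lemma abs2_indic E F x : abs2 (\1_E x - \1_F x : R[i]) = \1_(E `\` F `|` F `\` E) x.
Proof.
rewrite !indicE in_setU !in_setD.
by case: (x \in E); case: (x \in F); rewrite /= ?subr0 ?subrr ?sub0r ?abs2N ?abs2_0 ?abs2_1.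
Qed.

(** Dynkin's theorem: open measurable sets are stable under intersection, and
    the sets whose trace on the box has its indicator in W form a
    lambda-system. *)
Lemma csub_indic_bounded W r : closed_subspace W ->
  (forall O, open O -> measurable O -> O `<=` open_box r -> W (cindic O)) ->
  forall E, measurable E -> W (cindic (E `&` open_box r)).
Proof.
move=> cW WO E mE; set B := open_box r.
have mB : measurable B by exact: measurable_open_box.
pose H := [set E | measurable E /\ W (cindic (E `&` B))].
suff : measurable `<=` H by move=> /(_ E mE)[].
pose G := [set O : set 'cV[R]_n | open O /\ measurable O].
apply: (subset_trans measurable_sub_gen_open).
apply: lambda_system_subset => //.
- by move=> U1 U2 [oU1 mU1] [oU2 mU2]; split; [exact: openI|exact: measurableI].
- split=> //.
  + split; first exact: measurableT.
    by rewrite setTI; apply: WO => //; exact: open_open_box.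
  + move=> F1 F2 F21 [mF1 W1] [mF2 W2]; split; first exact: measurableD.
    rewrite (_ : cindic _ = (fun x => cindic (F1 `&` B) x - cindic (F2 `&` B) x)).
      exact: csubB.
    apply/funext => x; rewrite /cindic !indicE in_setI in_setD !in_setI.
    have : x \in F2 -> x \in F1 by rewrite !inE; exact: F21.
    case: (x \in F1); case: (x \in F2); case: (x \in B); rewrite /= ?subr0 ?subrr//;
      by move=> /(_ isT).
  + move=> F ndF HF; have mF m : measurable (F m) by have [] := HF m.
    have mUF : measurable (\bigcup_m F m) by exact: bigcupT_measurable.
    split => //.
    apply: (@csub_dominated _ _ _ (fun m => cindic (F m `&` B)) _ (\1_B)) => //.
    * by move=> m; have [] := HF m.
    * by apply: cmeasurable_indic; exact: measurableI.
    * by rewrite integral_indic// setIT; exact: lebesgue_open_box_lty.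
    * apply: nearW => x m; rewrite /cindic abs2_indic !indicE ler_nat.
      have : (x \in (\bigcup_m F m `&` B) `\` (F m `&` B) `|` (F m `&` B) `\` (\bigcup_m F m `&` B)) -> x \in B.
        by rewrite !inE => -[[[_ ?]]|[[_ ?]]].
      by case: (x \in _) => // ->.
    * apply: nearW => x; apply: cvg_near_cst.
      have [[N _ FNx]|nF] := pselect ((\bigcup_m F m) x); last first.
        apply: nearW => m; rewrite /cindic !indicE !memNset ?subrr ?abs2_0//.
          by move=> [FF _]; apply: nF; exists m.
        by move=> [].
      exists N => // m /= Nm; have FUx : (\bigcup_m F m) x by exists N.
      have Fmx : F m x by move/subsetPset : (ndF _ _ Nm); apply.
      rewrite /cindic !indicE !in_setI (mem_set Fmx) (mem_set FUx) /=.
      by rewrite subrr abs2_0.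
- by move=> O [oO mO]; split=> //; apply: WO;
    [apply: openI => //; exact: open_open_box|exact: measurableI|exact: subIsetr].
Qed.

Import HBNNSimple.

(** Simple functions increase to g; cut off to growing boxes, they are sums of
    indicators of bounded sets, and the squared error stays below g^2. *)
Lemma csub_nonneg_real W (g : 'cV[R]_n -> R) : closed_subspace W ->
  (forall r E, measurable E -> W (cindic (E `&` open_box r))) ->
  measurable_fun setT g -> (forall x, 0 <= g x) -> (\int[mu]_x (g x ^+ 2)%:E < +oo)%E ->
  W (fun x => real_complex R (g x)).
Proof.
move=> cW WE mg g0 g2; have mEg : measurable_fun setT (EFin \o g) by exact/measurable_EFinP.
pose a := nnsfun_approx measurableT mEg.
have abs2_real (z : R) : abs2 (real_complex R z) = z ^+ 2.
  by rewrite /abs2 /= expr0n addr0.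
pose u m (x : 'cV[R]_n) := real_complex R (a m x * \1_(open_box m%:R) x).
have aP m x : 0 <= a m x <= g x.
  apply/andP; split; first exact: fun_ge0.
  rewrite /a nnsfun_approxE -lee_fin; apply: le_approx => // y _.
  by rewrite /= lee_fin.
apply: (@csub_dominated _ _ W u _ (fun x => g x ^+ 2)) => //.
- move=> m; rewrite (_ : u m = fun x => \sum_(y <- finmap.enum_fset (fset_set (range (a m))))
      (real_complex R y * cindic (a m @^-1` [set y] `&` open_box m%:R) x)).
    apply: csub_sum => // y; apply: (csub_scale cW); exact: WE.
  apply/funext => x; rewrite /u fimfunE fsbig_finite//= mulr_suml rmorph_sum /=.
  apply: eq_bigr => y _; rewrite -mulrA rmorphM; congr (_ * _).
  by rewrite /cindic !indicE in_setI; case: (x \in _); case: (x \in _); rewrite /= ?mulr1 ?mulr0 ?mul0r.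
- exact: measurable_funX.
- by move=> x; exact: sqr_ge0.
- apply: nearW => x m; rewrite /u -rmorphB /= abs2_real ler_sqr ?nnegrE//.
    by rewrite indicE; have := aP m x; case: (x \in _); rewrite /= ?mulr1 ?mulr0; lra.
  by rewrite indicE; have := aP m x; case: (x \in _); rewrite /= ?mulr1 ?mulr0; lra.
- apply: nearW => x.
  under eq_fun do rewrite /u -rmorphB /= abs2_real.
  have ag : a m x @[m --> \oo] --> g x.
    under eq_fun do rewrite /a nnsfun_approxE.
    have := @cvg_approx _ _ _ setT (EFin \o g) x (fun y _ => g0 y) I (ltry _).
    exact.
  have box1 : (\1_(open_box m%:R) x : R) @[m --> \oo] --> (1 : R).
    apply: cvg_near_cst; exists (Num.bound (\sum_i `|x i ord0|)) => // m /= m_ge.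
    rewrite indicE mem_set// => i; apply: (@le_lt_trans _ _ (\sum_i `|x i ord0|)).
      by rewrite (bigD1 i)//= lerDl sumr_ge0.
    apply: (lt_le_trans (archi_boundP _)); first exact: sumr_ge0.
    by rewrite ler_nat.
  rewrite (_ : 0 = (g x - g x * 1) ^+ 2); last by rewrite mulr1 subrr expr0n.
  have d : (g x - a m x * \1_(open_box m%:R) x) @[m --> \oo] --> g x - g x * 1.
    by apply: cvgB; [exact: cvg_cst|exact: cvgM].
  by under eq_fun do rewrite expr2; rewrite expr2; exact: cvgM.
Qed.

(** The positive and negative parts of the real and imaginary parts of f are
    square-integrable, and f is a combination of them. *)
Lemma L2_sub_closed_subspace W : closed_subspace W ->
  (forall r O, open O -> measurable O -> O `<=` open_box r -> W (cindic O)) ->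
  @L2 R n `<=` W.
Proof.
move=> cW WO f /L2P[[mr mi] f2].
have WE r := csub_indic_bounded cW (WO r).
have part (p : R -> R) (q : R[i] -> R) :
    measurable_fun setT (fun x => q (f x)) -> (forall z, q z ^+ 2 <= abs2 z) ->
    measurable_fun setT p -> (forall t, 0 <= p t) -> (forall t, p t ^+ 2 <= t ^+ 2) ->
    W (fun x => real_complex R (p (q (f x)))).
  move=> mq q2 mp p0 p2; apply: csub_nonneg_real => //.
    exact: (measurableT_comp mp).
  apply: le_lt_trans f2; apply: ge0_le_integral => //.
  - by move=> x _; rewrite lee_fin sqr_ge0.
  - by apply/measurable_EFinP; apply: measurable_funX; exact: (measurableT_comp mp).
  - exact: emeasurable_abs2.
  - by move=> x _; rewrite lee_fin (le_trans (p2 _)).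
pose pos (t : R) := Num.max t 0; pose neg (t : R) := Num.max (0 - t) 0.
have mpos : measurable_fun setT pos by apply: measurable_maxr; [exact: measurable_id|exact: measurable_cst].
have mneg : measurable_fun setT neg by apply: measurable_maxr; [by apply: measurable_funB; [exact: measurable_cst|exact: measurable_id]|exact: measurable_cst].
have pos0 t : 0 <= pos t by rewrite le_max lexx orbT.
have neg0 t : 0 <= neg t by rewrite le_max lexx orbT.
have pos2 t : pos t ^+ 2 <= t ^+ 2.
  by rewrite /pos; case: (leP t 0) => ?; nra.
have neg2 t : neg t ^+ 2 <= t ^+ 2.
  by rewrite /neg; case: (leP (0 - t) 0) => ?; nra.
have posneg t : t = pos t - neg t.
  by rewrite /pos /neg; case: (leP t 0) => ?; case: (leP (0 - t) 0) => ?; lra.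
have Re2 (z : R[i]) : complex.Re z ^+ 2 <= abs2 z by rewrite lerDl sqr_ge0.
have Im2 (z : R[i]) : complex.Im z ^+ 2 <= abs2 z by rewrite lerDr sqr_ge0.
rewrite (_ : f = (fun x => real_complex R (pos (complex.Re (f x))) -
                           real_complex R (neg (complex.Re (f x)))) \+
   (fun x => 'i * (real_complex R (pos (complex.Im (f x))) -
                           real_complex R (neg (complex.Im (f x)))))).
  apply: (csub_add cW); first by apply: csubB => //; exact: part.
  by apply: (csub_scale cW); apply: csubB => //; exact: part.
apply/funext => x /=; rewrite -!rmorphB /= -!posneg.
by rewrite [LHS]complexE.
Qed.

End density.

(** * Self-affine tiles *)

(** If each candidate failed at some stage, all would fail at the latest of
    these stages.  This is the compactness argument behind the
    existence of digit sequences. *)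
Lemma finite_pigeonhole (K : choiceType) (D : set K) (P : nat -> K -> Prop) :
  finite_set D -> (forall N k, P N.+1 k -> P N k) ->
  (forall N, exists2 k, D k & P N k) -> exists2 k, D k & forall N, P N k.
Proof.
move=> /finite_seqP[s Ds] Pdec Pex; apply: contrapT => nP.
have Pmono N M k : (N <= M)%N -> P M k -> P N k.
  move=> /subnK <-; elim: (M - N)%N => // m IHm PM.
  by apply: IHm; apply: Pdec; rewrite addSn in PM.
have /choice[f fP] k : exists N, D k -> ~ P N k.
  apply: contrapT => H; apply: nP; exists k.
    by apply: contrapT => nDk; apply: H; exists 0%N.
  by move=> N; apply: contrapT => nPN; apply: H; exists N.
have [k Dk Pk] := Pex (\max_(k <- s) f k)%N.
apply: (fP k Dk); apply: Pmono Pk; apply: leq_bigmax_seq => //.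
by move: Dk; rewrite Ds.
Qed.

Section almost_disjoint.
Context d (T : measurableType d) (R : realType) (mu : {measure set T -> \bar R}).
Variables (K : choiceType) (s : seq K) (F : K -> set T).
Hypotheses (us : uniq s) (mF : forall k, measurable (F k)).

Lemma measure_bigsetU_seq_le (r : seq K) (G : K -> set T) :
  (forall k, measurable (G k)) ->
  (mu (\big[setU/set0]_(k <- r) G k) <= \sum_(k <- r) mu (G k))%E.
Proof.
move=> mG; elim: r => [|k r IHr]; first by rewrite !big_nil measure0.
rewrite !big_cons; apply: le_trans (leeD2l _ IHr).
by apply: measureU2 => //; exact: bigsetU_measurable.
Qed.

(** Shrinking F k to F k minus F l does not change the union, hence cannot
    decrease the sum of the measures, which already equals the measure of the
    union. *)
Lemma almost_disjoint k l :
  (forall k, mu (F k) < +oo)%E ->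
  mu (\big[setU/set0]_(k <- s) F k) = (\sum_(k <- s) mu (F k))%E ->
  k \in s -> l \in s -> k != l -> mu (F k `&` F l) = 0%E.
Proof.
move=> Foo Fsum ks ls kl.
pose F' i := if i == k then F k `\` F l else F i.
have mF' i : measurable (F' i).
  by rewrite /F'; case: ifP => // _; exact: measurableD.
have Foo' : (\sum_(i <- s | i != k) mu (F i) \is a fin_num)%E.
  by apply/sum_fin_numP => i _ _; rewrite ge0_fin_numE.
have : (\sum_(i <- s) mu (F i) <= \sum_(i <- s) mu (F' i))%E.
  rewrite -Fsum; apply: le_trans (measure_bigsetU_seq_le _ mF').
  rewrite -!bigcup_seq; apply: le_measure; rewrite ?inE.
  - by apply: fin_bigcup_measurable => //; exact: finite_seq.
  - by apply: fin_bigcup_measurable => //; exact: finite_seq.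
  move=> x [i /= is_ Fix]; have [ik|ik] := eqVneq i k.
    have [Fl|Fl] := pselect (F l x).
      by exists l => //=; rewrite /F' eq_sym (negbTE kl).
    by exists k => //=; rewrite /F' eqxx; split => //; rewrite -ik.
  by exists i => //=; rewrite /F' (negbTE ik).
rewrite (bigD1_seq k)//= [leRHS](bigD1_seq k)//= {1}/F' eqxx.
rewrite [X in (_ <= _ + X)%E](eq_bigr (fun i => mu (F i))); last first.
  by move=> i ik; rewrite /F' (negbTE ik).
rewrite leeD2rE// => kle.
have := measureDI mu (mF k) (mF l) => E; move: kle; rewrite {1}E.
have fD : mu (F k `\` F l) \is a fin_num.
  rewrite ge0_fin_numE//; apply: le_lt_trans (Foo k).
  by apply: le_measure; rewrite ?inE//; exact: measurableD.
rewrite -[leRHS]adde0 leeD2lE// => H.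
by apply/eqP; rewrite eq_le H measure_ge0.
Qed.
End almost_disjoint.

Lemma cvg_colvec (R : realType) n (u : nat -> 'cV[R]_n) (x : 'cV[R]_n) :
  (u @ \oo --> x) <-> (forall i, u N i ord0 @[N --> \oo] --> x i ord0).
Proof.
split=> [ux i|ux].
  exact: (cvg_comp _ _ ux (@coord_continuous _ _ _ i ord0 x)).
apply/cvg_ballP => e e0.
have : \forall N \near \oo, forall i, ball (x i ord0) e (u N i ord0).
  apply: filter_forall => i; exact: (cvg_ball (ux i)).
apply: filterS => N H; split => // i j; rewrite ord1; exact: H.
Qed.

Lemma cvg_mulmx (R : realType) m n (C : 'M[R]_(m, n)) (u : nat -> 'cV[R]_n) (x : 'cV[R]_n) i :
  (forall k, u N k ord0 @[N --> \oo] --> x k ord0) ->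
  (C *m u N) i ord0 @[N --> \oo] --> (C *m x) i ord0.
Proof.
move=> ux; rewrite mxE; under eq_fun do rewrite mxE.
apply: cvg_big => [|k _]; first exact: add_continuous.
by apply: cvgM; [exact: cvg_cst|exact: ux].
Qed.

Section self_affine_tile.
Context (R : realType) (n : nat) (A : 'M[int]_n) (D : set 'cV[int]_n).
Local Notation mu := (lebesgue_colvec R n).
Local Notation Z := (@intmx R n 1).
Local Notation Am := (intmx R A).
Local Notation B := (invmx (intmx R A)).
Local Notation T := (@tile R n A D).
Hypothesis uA : Am \in unitmx.
Variables (s K : R).
Hypotheses (s0 : 0 < s) (s1 : s < 1) (K0 : 0 < K).
Hypothesis decay : forall j a b, `|(B ^+ j) a b| <= K * s ^+ j.
Hypothesis digD : digit_set A D.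

Let decay_vec (x : 'cV[R]_n) (r : R) j i : (forall i, `|x i ord0| <= r) ->
  `|(B ^+ j *m x) i ord0| <= n%:R * K * r * s ^+ j.
Proof.
move=> xr; rewrite mxE (le_trans (ler_norm_sum _ _ _))//.
rewrite (_ : _ * s ^+ j = \sum_(k < n) K * s ^+ j * r); last first.
  by rewrite sumr_const card_ord -mulr_natl; ring.
by apply: ler_sum => k _; rewrite normrM ler_pM.
Qed.

(** Subtracting from x the image under A of the integer part of A^(-1) x is
    injective on D, because it does not change the coset of x, and its values
    lie in the image of the unit cube, which is bounded. *)
Lemma finite_digits : finite_set D.
Proof.
have [D0 Dex] := digD.
have /choice[k0 k0P] x := @unit_cube_covers R n (B *m Z x).
pose red x := x - A *m k0 x.
have red_inj : {in D &, injective red}.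
  move=> x y /[!inE] Dx Dy xy; have [d [_ dU]] := Dex x.
  rewrite -(dU x); last by split=> //; exists 0; rewrite mulmx0 addr0.
  apply: dU; split => //; exists (k0 x - k0 y).
  move: xy; rewrite /red mulmxBr; move: (A *m k0 x) (A *m k0 y) => a b xab.
  by apply: (addIr (- a)); rewrite xab [a - b]addrC addrA addrK.
rewrite -(eq_finite_set (inj_card_eq red_inj)).
apply: sub_finite_set (finite_bounded_lattice n (\sum_i \sum_j `|Am i j|)) => _ [x Dx <-] i.
have -> : Z (red x) = Am *m (B *m Z x - Z (k0 x)).
  by rewrite mulmxBr mulKVmx// intmxB intmxM.
rewrite mxE (le_trans (ler_norm_sum _ _ _))// [leRHS](bigD1 i)//= ler_wpDr//.
  by apply: sumr_ge0 => j _; exact: sumr_ge0.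
apply: ler_sum => j _; rewrite normrM ler_piMr//.
by have /andP[h0 /ltW h1] := k0P x j; rewrite ger0_norm.
Qed.

(** Bounds the entries of the digits, and those of the unit cube as well. *)
Let delta : R := 1 + \sum_(d <- finmap.enum_fset (fset_set D)) \sum_i `|Z d i ord0|.

Let delta_ge1 : 1 <= delta.
Proof. by rewrite lerDl; apply: sumr_ge0 => d _; exact: sumr_ge0. Qed.

Let digit_le d i : D d -> `|Z d i ord0| <= delta.
Proof.
move=> Dd; rewrite /delta ler_wpDl// [leRHS](bigD1_seq d)//=; last 2 first.
- by rewrite in_fset_set ?inE//; exact: finite_digits.
- exact: finmap.fset_uniq.
rewrite ler_wpDr//; first by apply: sumr_ge0 => e _; exact: sumr_ge0.
by rewrite [leRHS](bigD1 i)//= ler_wpDr// sumr_ge0.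
Qed.

Let c : R := n%:R * K * delta.
(** Large enough that (M + c) s <= M, for [FG], and that M >= c, for the unit
    cube to lie in G. *)
Let M : R := c / (1 - s).

Let c_ge0 : 0 <= c.
Proof.
apply: mulr_ge0; first by rewrite mulr_ge0// ltW.
exact: le_trans delta_ge1.
Qed.

Let ME : M * (1 - s) = c.
Proof. by rewrite divfK// subr_eq0 gt_eqF. Qed.

Let M_ge0 : 0 <= M.
Proof. by rewrite divr_ge0// subr_ge0 ltW. Qed.

(** A bounded set mapped into itself by all the maps y |-> A^(-1) (y + d).  With
    the decay of the whole orbit in its definition, this holds for the usual
    coordinates, although A^(-1) need not contract them. *)
Let G : set 'cV[R]_n := [set x | forall m i, `|(B ^+ m *m x) i ord0| <= M * s ^+ m].

(** One step of the iterated function system of the tile. *)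
Let F (S : set 'cV[R]_n) : set 'cV[R]_n :=
  [set x | exists2 d, D d & S (Am *m x - Z d)].

Let GN N := iter N F G.

Let F_mono S S' : S `<=` S' -> F S `<=` F S'.
Proof. by move=> SS x [d Dd Sd]; exists d => //; exact: SS. Qed.

Let FG : F G `<=` G.
Proof.
move=> x [d Dd Gd] m i.
have -> : B ^+ m *m x = B ^+ m.+1 *m (Am *m x - Z d) + B ^+ m.+1 *m Z d.
  by rewrite -mulmxDr subrK exprSr -mulmxA mulKmx.
rewrite mxE (le_trans (ler_normD _ _))//.
apply: (@le_trans _ _ (M * s ^+ m.+1 + c * s ^+ m.+1)).
  by rewrite lerD//; apply: decay_vec => k; exact: digit_le.
rewrite -mulrDl exprS mulrA ler_wpM2r ?exprn_ge0 ?(ltW s0)//.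
have cs : 0 <= c * (1 - s) by rewrite mulr_ge0// subr_ge0 ltW.
by have := ME; lra.
Qed.

Let GN_dec N x : GN N.+1 x -> GN N x.
Proof. by elim: N x => [|N IHN] x; [exact: FG|exact: F_mono]. Qed.

Let GN_G N : GN N `<=` G.
Proof. by elim: N => // N IHN x /GN_dec; exact: IHN. Qed.

(** The attractor; [tile_attr] identifies it with the tile. *)
Let attr : set 'cV[R]_n := \bigcap_N GN N.

Let attr_sub : attr `<=` F attr.
Proof.
move=> x xT.
have [|N k|N|d Dd H] := @finite_pigeonhole _ D (fun N d => GN N (Am *m x - Z d)).
- exact: finite_digits.
- exact: GN_dec.
- exact: (xT N.+1 I).
- by exists d => // N _; exact: H.
Qed.

(** A point x of the attractor has a digit d such that A x - d is in the
    attractor; repeating this gives the digits of x.  After N digits the error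
    is the N-th power of the inverse of A applied to a point of G. *)
Let attr_tile : attr `<=` T.
Proof.
move=> x xT.
have /choice[dig digP] y : exists d, attr y -> D d /\ attr (Am *m y - Z d).
  have [ay|] := pselect (attr y); last by exists 0.
  by have [d Dd ad] := attr_sub ay; exists d.
pose r := fix r N := if N is N'.+1 then Am *m r N' - Z (dig (r N')) else x.
have rP N : attr (r N) by elim: N => //= N IHN; have [] := digP _ IHN.
exists (fun j => dig (r j.-1)); split=> [j j1|]; first by have [] := digP _ (rP j.-1).
have SE N : \sum_(1 <= j < N.+1) B ^+ j *m Z (dig (r j.-1)) = x - B ^+ N *m r N.
  elim: N => [|N IHN]; first by rewrite big_geq// expr0 mul1mx subrr.
  have E : B ^+ N.+1 *m (Am *m r N) = B ^+ N *m r N by rewrite exprSr -mulmxA mulKmx.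
  by rewrite big_nat_recr//= IHN mulmxBr E opprB addrCA addrC.
apply/cvg_colvec => i; under eq_fun do rewrite SE.
under eq_fun do rewrite mxE [X in _ + X]mxE.
suff : (B ^+ N *m r N) i ord0 @[N --> \oo] --> (0 : R).
  move=> H.
  have : (x i ord0 - (B ^+ N *m r N) i ord0) @[N --> \oo] --> x i ord0 - 0.
    by apply: cvgB => //; exact: cvg_cst.
  by rewrite subr0; exact.
apply/norm_cvg0P.
apply: (@squeeze_cvgr _ _ _ _ (cst 0) (fun N => n%:R * K * M * s ^+ N)).
- apply: nearW => N; rewrite normr_ge0 /=; apply: decay_vec => k.
  have := GN_G (rP N 0%N I) 0%N k.
  by rewrite expr0 mul1mx expr0 mulr1.
- exact: cvg_cst.
- have sN : s ^+ N @[N --> \oo] --> (0 : R) by apply: cvg_expr; rewrite ger0_norm// ltW.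
  have : n%:R * K * M * s ^+ N @[N --> \oo] --> n%:R * K * M * 0.
    by apply: cvgM => //; exact: cvg_cst.
  by rewrite mulr0; exact.
Qed.

(** Multiplication by A shifts the digits. *)
Let tile_step : T `<=` F T.
Proof.
move=> x [dig [digD' /cvg_colvec cv]]; exists (dig 1%N); first exact: digD'.
exists (fun j => dig j.+1); split=> [j _|]; first exact: digD'.
set u := (fun N : nat => \sum_(1 <= j < N.+1) B ^+ j *m Z (dig j)) in cv.
have E N : \sum_(1 <= j < N.+1) B ^+ j *m Z (dig j.+1) = Am *m u N.+1 - Z (dig 1%N).
  rewrite /u [in RHS]big_ltn// mulmxDr expr1 mulKVmx// addrAC subrr add0r mulmx_sumr.
  rewrite [RHS]big_add1; apply: eq_big_nat => j /andP[j1 _].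
  by rewrite exprS -mulmxA mulKVmx.
under eq_fun do rewrite E.
apply/cvg_colvec => i; rewrite mxE; under eq_fun do rewrite mxE.
apply: cvgD; last exact: cvg_cst.
apply: (cvg_mulmx (u := fun N => u N.+1)) => k.
by have := cv k; rewrite -(cvg_shiftS (fun N => u N k ord0)).
Qed.

Let tile_sub_G : T `<=` G.
Proof.
move=> x [dig [digD' /cvg_colvec cv]] m i.
set u := (fun N : nat => \sum_(1 <= j < N.+1) B ^+ j *m Z (dig j)) in cv.
have uG N : `|(B ^+ m *m u N) i ord0| <= M * s ^+ m.
  have H : `|(B ^+ m *m u N) i ord0| <= (M - M * s ^+ N) * s ^+ m.
    elim: N => [|N IHN].
      by rewrite /u big_geq// mulmx0 mxE normr0 expr0 mulr1 subrr mul0r.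
    rewrite /u big_nat_recr//= -/(u N) mulmxDr mxE (le_trans (ler_normD _ _))//.
    have E : B ^+ m *m (B ^+ N.+1 *m Z (dig N.+1)) = B ^+ (m + N.+1) *m Z (dig N.+1).
      by rewrite mulmxA exprD.
    rewrite {}E.
    apply: (@le_trans _ _ ((M - M * s ^+ N) * s ^+ m + c * s ^+ (m + N.+1))).
      by rewrite lerD//; apply: decay_vec => k; apply: digit_le; exact: digD'.
    rewrite -ME exprD exprS -subr_ge0.
    rewrite (_ : _ - _ = M * (1 - s) * (1 - s) * (s ^+ N * s ^+ m)); last by ring.
    have s0' := ltW s0; have s1' : 0 <= 1 - s by rewrite subr_ge0 ltW.
    by repeat apply: mulr_ge0 => //; exact: exprn_ge0.
  apply: (le_trans H); rewrite ler_wpM2r ?exprn_ge0 ?(ltW s0)// gerBl.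
  by rewrite mulr_ge0// exprn_ge0// ltW.
have : `|(B ^+ m *m u N) i ord0| @[N --> \oo] --> `|(B ^+ m *m x) i ord0|.
  by apply: cvg_norm; exact: cvg_mulmx.
move=> H; rewrite -(cvg_lim _ H)//; apply: limr_le; last exact: nearW.
by apply/cvg_ex; exists `|(B ^+ m *m x) i ord0|.
Qed.

Let tile_attr : T = attr.
Proof.
apply/seteqP; split; last exact: attr_tile.
move=> x Tx N _; elim: N x Tx => [|N IHN] x Tx; first exact: tile_sub_G.
by have [d Dd Td] := tile_step Tx; exists d => //; exact: IHN.
Qed.

Lemma tileE x : T x <-> exists2 d, D d & T (Am *m x - Z d).
Proof.
split; first exact: tile_step.
move=> [d Dd]; rewrite tile_attr => Td N _; apply: GN_dec.
by exists d => //; exact: Td.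
Qed.

(** The iterates of F on G are finite unions of preimages of G. *)
Lemma measurable_tile : measurable T.
Proof.
rewrite tile_attr; apply: bigcapT_measurable => N; elim: N => [|N IHN].
  rewrite /GN /= (_ : G = \bigcap_m \bigcap_(i in [set: 'I_n])
     (fun x : 'cV[R]_n => (B ^+ m *m x) i ord0) @^-1` `[- (M * s ^+ m), M * s ^+ m]%classic).
    apply: bigcapT_measurable => m; apply: fin_bigcap_measurable => // i _.
    apply: preimage_measurable; last exact: measurable_itv.
    apply: (measurableT_comp (measurable_coor i)); exact: measurable_mulmx.
  apply/seteqP; split => [x Gx m _ i _|x Gx m i] /=.
    by rewrite in_itv /= -ler_norml; exact: Gx.
  by have := Gx m I i I; rewrite /= in_itv /= -ler_norml.
rewrite (_ : GN N.+1 = \bigcup_(d in D) ((fun x => Am *m x - Z d) @^-1` GN N)).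
  apply: fin_bigcup_measurable; first exact: finite_digits.
  move=> d _; apply: preimage_measurable => //.
  apply: (measurableT_comp (f := fun x : 'cV[R]_n => x - Z d)).
    exact: measurable_colvec_translate.
  exact: measurable_mulmx.
by apply/seteqP; split => x [d Dd Gd]; exists d.
Qed.

Let tile_bounded x i m : T x -> `|(B ^+ m *m x) i ord0| <= M * s ^+ m.
Proof. by move=> /tile_sub_G; apply. Qed.

(** Peeling a digit off an integer vector k near A y leaves A m, with m an
    integer vector near y. *)
Let GN_covers N y : exists k, GN N (y - Z k).
Proof.
elim: N y => [|N IHN] y.
  have [k kP] := @unit_cube_covers R n y; exists k => m i.
  apply: (@le_trans _ _ (n%:R * K * 1 * s ^+ m)).
    by apply: decay_vec => j; have /andP[h0 /ltW h1] := kP j; rewrite ger0_norm.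
  rewrite ler_wpM2r ?exprn_ge0 ?(ltW s0)//.
  apply: (@le_trans _ _ c); first by rewrite ler_wpM2l// mulr_ge0// ltW.
  have cs : 0 <= M * s by rewrite mulr_ge0// ltW.
  by have := ME; lra.
have [k kP] := IHN (Am *m y).
have [d [[Dd [m kE]] _]] := digD.2 k.
exists m, d => //; rewrite mulmxBr -addrA -opprD -intmxM -intmxD.
by rewrite [A *m m + d]addrC -kE.
Qed.

(** The integer vectors found at the successive stages remain at bounded
    distance from y, so one of them serves for all stages. *)
Lemma tile_covers : covers T.
Proof.
move=> y; rewrite /shift /=.
pose L := [set k : 'cV[int]_n | forall i, `|Z k i ord0| <= M + \sum_i `|y i ord0|].
have [||N|k _ kP] := @finite_pigeonhole _ L (fun N k => GN N (y - Z k)).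
- exact: finite_bounded_lattice.
- by move=> N k; exact: GN_dec.
- have [k kP] := GN_covers N y; exists k => // i.
  have := GN_G kP 0%N i; rewrite expr0 mul1mx expr0 mulr1 mxE [X in _ + X]mxE => H.
  rewrite -[Z k i ord0](subKr (y i ord0)) (le_trans (ler_normB _ _))// addrC lerD//.
  by rewrite (bigD1 i)//= lerDl sumr_ge0.
by exists k; rewrite tile_attr => N _; exact: kP.
Qed.

Lemma tile_decay : exists2 r : R, 0 <= r &
  forall x i m, T x -> `|(B ^+ m *m x) i ord0| <= r * s ^+ m.
Proof. by exists M => // x i m; exact: tile_bounded. Qed.

Let tile_lty : (mu T < +oo)%E.
Proof.
apply: (@lebesgue_colvec_bounded _ _ _ M); first exact: measurable_tile.
by move=> x Tx i; have := tile_bounded i 0%N Tx; rewrite expr0 mul1mx expr0 mulr1.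
Qed.

Let ds := finmap.enum_fset (fset_set D).

Let dsP d : d \in ds <-> D d.
Proof. by rewrite in_fset_set ?inE//; exact: finite_digits. Qed.

Let mu_mulmx_shift d P : measurable P ->
  mu ((fun x => Am *m x) @^-1` shift d P) = ((modulus Am)%:E * mu P)%E.
Proof.
by move=> mP; rewrite mulmx_preimageE ?lebesgue_shift//; exact: measurable_shift.
Qed.

Let measurable_mulmx_shift d P : measurable P ->
  measurable ((fun x => Am *m x) @^-1` shift d P).
Proof.
move=> mP; apply: preimage_measurable; first exact: measurable_mulmx.
exact: measurable_shift.
Qed.

(** The modulus of A is 1 / #D: the preimages of the unit cube Q under the maps
    x |-> A x - d, for d in D, are disjoint, and their union U packs and
    covers like Q itself. *)
Let modulus_digits : (\sum_(d <- ds) (modulus Am)%:E = 1)%E.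
Proof.
have mQ := @measurable_unit_cube R n.
pose U := \big[setU/set0]_(d <- ds) ((fun x => Am *m x) @^-1` shift d (@unit_cube R n)).
have UE x : U x <-> exists2 d, D d & unit_cube (Am *m x - Z d).
  rewrite /U -bigcup_seq; split=> [[d /= + ?]|[d Dd ?]]; exists d => //=; exact/dsP.
have mU : measurable U by apply: bigsetU_measurable => d _; exact: measurable_mulmx_shift.
have qcov := @unit_cube_covers R n; have qpack := @unit_cube_packs R n.
have U1 : mu U = 1%E.
  apply/eqP; rewrite eq_le covers_measure_ge1// ?ae_packs_measure_le1//.
    apply: packs_ae => k l x /UE[d Dd kd] /UE[d' Dd' ld].
    have E : A *m k + d = A *m l + d'.
      apply: (qpack _ _ (Am *m x)); rewrite /shift /= intmxD intmxM.
        by move: kd; rewrite mulmxBr -addrA -opprD.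
      by move: ld; rewrite mulmxBr -addrA -opprD.
    have [e [_ eU]] := digD.2 d.
    have dd' : d = d'.
      rewrite -(eU d); last by split=> //; exists 0; rewrite mulmx0 addr0.
      apply: eU; split=> //; exists (l - k); rewrite mulmxBr addrA [d' + _]addrC -E.
      by rewrite addrAC subrr add0r.
    move: E; rewrite dd' => /addIr E; apply: (@intmx_inj R).
    by rewrite -[LHS](mulKmx uA) -intmxM E intmxM mulKmx.
  move=> x; have [k0 k0P] := qcov (Am *m x).
  have [d [[Dd [m kE]] _]] := digD.2 k0; exists m; apply/UE; exists d => //.
  move: k0P; rewrite /shift /= kE intmxD intmxM mulmxBr [Z d + _]addrC.
  by rewrite opprD addrA.
rewrite -[RHS]U1 /U measure_fbigsetU.
- apply: eq_bigr => d _; rewrite -[LHS]mule1 -(lebesgue_unit_cube R n).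
  by apply/esym; exact: mu_mulmx_shift.
- by move=> d _; exact: measurable_mulmx_shift.
- by move=> d d' _ _ [x [xd xd']]; exact: (qpack _ _ (Am *m x)).
Qed.

(** The tile is the union of its pieces, and the measures of the pieces add up
    to that of the tile. *)
Let tile_digit_overlap d d' : D d -> D d' -> d != d' ->
  mu ((fun x => Am *m x) @^-1` (shift d T `&` shift d' T)) = 0%E.
Proof.
move=> Dd Dd' dd'; have mT := measurable_tile.
pose F0 e := (fun x => Am *m x) @^-1` shift e T.
apply: (@almost_disjoint _ _ R mu _ ds F0) => //.
- exact: finmap.fset_uniq.
- by move=> e; exact: measurable_mulmx_shift.
- move=> e; rewrite [X in (X < _)%E](_ : _ = ((modulus Am)%:E * mu T)%E); last first.
    exact: mu_mulmx_shift.
  by rewrite lte_mul_pinfty ?lee_fin ?modulus_ge0//; exact: tile_lty.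
- transitivity (mu T).
    apply: (congr1 mu); rewrite -bigcup_seq; apply/seteqP; split=> [x [e /= + Te]|x /tileE[e De Te]].
      by move=> /dsP De; apply/tileE; exists e.
    by exists e => //=; exact/dsP.
  rewrite (eq_bigr (fun=> (modulus Am)%:E * mu T)%E); last first.
    by move=> e _; exact: mu_mulmx_shift.
  by rewrite -ge0_sume_distrl ?modulus_digits ?mul1e// => e _; rewrite lee_fin modulus_ge0.
- exact/dsP.
- exact/dsP.
Qed.

(** Expansions with N digits, possibly with leading zeros.  The recursion
    removes the lowest digit, to match the way a tile splits into pieces. *)
Fixpoint radix_length N (x : 'cV[int]_n) : Prop :=
  if N is N'.+1 then exists d m, [/\ D d, radix_length N' m & x = d + A *m m]
  else x = 0.

Let radix_lengthW N x : radix_length N x -> radix_length N.+1 x.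
Proof.
elim: N x => [|N IHN] x /=.
  by move=> ->; exists 0, 0; split=> //; [exact: digD.1|rewrite mulmx0 addr0].
by move=> [d [m [Dd /IHN mN ->]]]; exists d, m.
Qed.

Let radix_length_le N N' x : (N <= N')%N -> radix_length N x -> radix_length N' x.
Proof.
move=> /subnK <-; elim: (N' - N)%N => // k IHk xN.
by rewrite addSn; apply: radix_lengthW; exact: IHk.
Qed.

Let radix_length_sum N d : (forall j, (j < N)%N -> D (d j)) ->
  radix_length N (\sum_(0 <= j < N) A ^+ j *m d j).
Proof.
elim: N d => [|N IHN] d dD; first by rewrite big_geq.
exists (d 0%N), (\sum_(0 <= j < N) A ^+ j *m d j.+1); split.
- exact: dD.
- by apply: IHN => j jN; exact: dD.
rewrite big_nat_recl// expr0 mul1mx mulmx_sumr; congr (_ + _).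
by apply: eq_bigr => j _; rewrite exprS mulmxA.
Qed.

Let shift_step d m : shift (d + A *m m) T =
  (fun x => B *m x) @^-1` shift m ((fun x => Am *m x) @^-1` shift d T).
Proof.
apply/funext => x; rewrite /shift /= mulmxBr mulKVmx// intmxD intmxM.
by rewrite [Z d + _]addrC opprD addrA.
Qed.

(** For k = d + A m, the set T + k is the image under A of one piece of T + m.
    So the overlap of T + k and T + l is controlled by an overlap of two shorter
    translates if these differ, and by one of two pieces of the same tile if
    they agree. *)
Lemma tile_ae_packs : radix_representation A D -> ae_packs T.
Proof.
move=> radD; have mT := measurable_tile.
have uB : B \in unitmx by rewrite unitmx_inv.
suff H N k l : radix_length N k -> radix_length N l -> k != l ->
    mu (shift k T `&` shift l T) = 0%E.
  move=> k l kl; have [N [d [dD kE]]] := radD k; have [N' [d' [d'D lE]]] := radD l.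
  apply: (H (maxn N.+1 N'.+1)) => //.
    by apply: (radix_length_le (leq_maxl _ _)); rewrite kE; exact: radix_length_sum.
  by apply: (radix_length_le (leq_maxr _ _)); rewrite lE; exact: radix_length_sum.
elim: N k l => [|N IHN] k l /=; first by move=> -> ->; rewrite eqxx.
move=> [d [m [Dd mN ->]]] [d' [m' [Dd' mN' ->]]] kl.
rewrite !shift_step -preimage_setI mulmx_preimageE//; last first.
  by apply: measurableI; apply: measurable_shift; exact: measurable_mulmx_shift.
have [mm'|mm'] := eqVneq m m'.
  subst m'; rewrite /shift -preimage_setI lebesgue_shift.
    rewrite -preimage_setI tile_digit_overlap ?mule0//.
    by apply: contra_neq kl => ->.
  by apply: measurableI; exact: measurable_mulmx_shift.
rewrite (_ : mu _ = 0%E) ?mule0//.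
apply/eqP; rewrite -measure_le0 -(IHN _ _ mN mN' mm') le_measure ?inE//.
- by apply: measurableI; apply: measurable_shift; exact: measurable_mulmx_shift.
- by apply: measurableI; exact: measurable_shift.
- by move=> x [xm xm']; split; apply/tileE; [exists d|exists d'].
Qed.

Lemma lebesgue_tile : radix_representation A D -> mu T = 1%E.
Proof.
move=> radD; have mT := measurable_tile.
apply/eqP; rewrite eq_le ae_packs_measure_le1//; last exact: tile_ae_packs.
by rewrite covers_measure_ge1//; exact: tile_covers.
Qed.

End self_affine_tile.

(** * The multiresolution analysis of a self-affine tiling *)

Section tiling_multiresolution.
Context (R : realType) (n : nat) (A : 'M[int]_n.+1) (D : set 'cV[int]_n.+1).
Variable T : set 'cV[R]_n.+1.
Local Notation mu := (lebesgue_colvec R n.+1).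
Local Notation Z := (@intmx R n.+1 1).
Local Notation Am := (intmx R A).
Local Notation B := (invmx (intmx R A)).
Hypotheses (uA : Am \in unitmx) (fD : finite_set D).
Hypotheses (mT : measurable T) (muT : mu T = 1%E) (packT : ae_packs T) (covT : covers T).
Hypothesis stepT : forall x, T x <-> exists2 d, D d & T (Am *m x - Z d).
Variables r s : R.
Hypotheses (s0 : 0 < s) (s1 : s < 1).
Hypothesis decayT : forall x i m, T x -> `|(B ^+ m *m x) i ord0| <= r * s ^+ m.
Hypothesis modulus_lt1 : modulus Am < 1.
Implicit Types f g h : 'cV[R]_n.+1 -> R[i].

Let e (k : 'cV[int]_n.+1) : 'cV[R]_n.+1 -> R[i] := fun x => cindic T (x - Z k).

Let eE k : e k = cindic (shift k T). Proof. by []. Qed.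

Let msT k : measurable (shift k T). Proof. exact: measurable_shift. Qed.

Let overlaps : set 'cV[R]_n.+1 :=
  \bigcup_(kl : 'cV[int]_n.+1 * 'cV[int]_n.+1)
    (if kl.1 == kl.2 then set0 else shift kl.1 T `&` shift kl.2 T).

Let measurable_overlaps : measurable overlaps.
Proof.
apply: measurable_countbigcup => -[k l] /=; case: ifP => // _.
exact: measurableI.
Qed.

Let overlaps0 : mu overlaps = 0%E.
Proof.
apply: measure_countbigcup0 => -[k l] /=.
  by case: ifP => // _; exact: measurableI.
case: eqVneq => [_|kl]; first by rewrite measure0.
exact: packT.
Qed.

Let no_overlap x k l : ~ overlaps x -> shift k T x -> shift l T x -> k = l.
Proof.
move=> xN kx lx; apply: contrapT => /eqP kl; apply: xN.
by exists (k, l) => //=; rewrite (negbTE kl).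
Qed.

Let off_overlaps (P : 'cV[R]_n.+1 -> Prop) : (forall x, ~ overlaps x -> P x) ->
  {ae mu, forall x, P x}.
Proof.
move=> H; exists overlaps; split => // x /= nPx; apply: contrapT => /H; exact: nPx.
Qed.

(** Off the overlaps at most one term of the sum is nonzero. *)
Let sum_translates (ks : seq 'cV[int]_n.+1) x : uniq ks -> ~ overlaps x ->
  \sum_(k <- ks) e k x = cindic (\bigcup_(k in [set` ks]) shift k T) x.
Proof.
move=> uks xN; rewrite /cindic indicE.
have [[k /= kks kx]|nx] := pselect ((\bigcup_(k in [set` ks]) shift k T) x).
  rewrite mem_set//; last by exists k.
  rewrite (bigD1_seq k)//= big1 => [|l lk]; rewrite eE /cindic indicE.
    by rewrite mem_set// addr0.
  rewrite memNset// => lx; move/eqP : lk; apply; exact: no_overlap lx kx.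
rewrite memNset// big_seq big1// => k kks; rewrite eE /cindic indicE memNset//.
by move=> kx; apply: nx; exists k.
Qed.

Let abs2_cindic (E : set 'cV[R]_n.+1) x : abs2 (cindic E x) = \1_E x.
Proof. by rewrite /cindic !indicE; case: (x \in E); rewrite ?abs2_0 ?abs2_1. Qed.

Let sqint_cindic (E : set 'cV[R]_n.+1) : measurable E -> sqint (cindic E) = mu E.
Proof.
move=> mE; rewrite /sqint.
transitivity (\int[mu]_x (\1_E x)%:E)%E; last by rewrite integral_indic// setIT.
by apply: eq_integral => x _; rewrite abs2_cindic.
Qed.

Let e_L2 k : L2 (e k).
Proof.
apply/L2P; split; first exact: (cmeasurable_indic (msT k)).
rewrite eE sqint_cindic// lebesgue_shift// muT; exact: ltry.
Qed.

Let V0 := L2closure (lin_span e).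

Let cV0 : closed_subspace V0. Proof. exact: closed_subspace_span. Qed.

Let V0_e k : V0 (e k).
Proof. by apply: sub_L2closure; [exact: lin_span_L2|exact: lin_span_mem]. Qed.

Let V0_translate f k : V0 f -> V0 (fun x => f (x - Z k)).
Proof.
move=> /L2closureP[Lf Hf]; have /L2P[mf f2] := Lf; apply/L2closureP; split.
  apply/L2P; split; last by rewrite sqint_translate.
  by apply: cmeasurable_comp => //; exact: measurable_colvec_translate.
move=> eps eps0; have [g Sg fg] := Hf _ eps0.
have /L2P[mg _] := lin_span_L2 e_L2 Sg.
exists (fun x => g (x - Z k)).
  case: Sg => [ks [c ->]]; exists (map (+%R^~ k) ks), (fun l => c (l - k)).
  apply/funext => x; rewrite big_map; apply: eq_bigr => l _.
  by rewrite addrK /e intmxD opprD addrAC addrA.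
rewrite (sqint_translate (Z k) (f := fun x => f x - g x))//; exact: cmeasurableB.
Qed.

(** The refinement equation: the dilated tile is the union of its translates by
    the digits, hence its indicator is almost everywhere a finite sum of
    generators. *)
Let V0_refine f : V0 f -> V0 (fun x => f (B *m x)).
Proof.
have uB : B \in unitmx by rewrite unitmx_inv.
apply: (closed_span_sub (csub_comp uB cV0)) => k /=.
have [ds [uds dsP]] : exists ds : seq 'cV[int]_n.+1, uniq ds /\ forall d, d \in ds <-> D d.
  exists (finmap.enum_fset (fset_set D)); split; first exact: finmap.fset_uniq.
  by move=> d; rewrite in_fset_set ?inE.
pose ks := [seq A *m k + d | d <- ds].
have uks : uniq ks by rewrite map_inj_uniq// => d d' /addrI.
apply: (@csub_ae _ _ _ (fun x => \sum_(l <- ks) e l x)) => //.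
- exact: csub_sum.
- apply: cmeasurable_comp; first exact: measurable_mulmx.
  by have /L2P[] := e_L2 k.
apply: off_overlaps => x xN; rewrite sum_translates// /e /cindic.
rewrite !indicE; congr ((_ : bool)%:R); apply/idP/idP; rewrite !inE.
  move=> /stepT[d Dd]; rewrite mulmxBr mulKVmx// => Td.
  exists (A *m k + d) => /=; first by apply: map_f; apply/dsP.
  by rewrite /shift /= intmxD intmxM opprD addrA.
move=> [_ /= /mapP[d /dsP Dd ->]]; rewrite /shift /= intmxD intmxM opprD addrA => Td.
by apply/stepT; exists d => //; rewrite mulmxBr mulKVmx.
Qed.

(** A linear combination of the generators is constant on the part of a tile
    off the overlaps, and this part has measure 1. *)
Let span_bound g x : lin_span e g -> ~ overlaps x -> ((abs2 (g x))%:E <= sqint g)%E.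
Proof.
move=> Sg xN; have /L2P[mg _] := lin_span_L2 e_L2 Sg; have [k kx] := covT x.
pose P := shift k T `\` overlaps.
have mP : measurable P by exact: measurableD.
have muP : mu P = 1%E.
  have muk : mu (shift k T) = 1%E by rewrite lebesgue_shift.
  apply/eqP; rewrite eq_le; apply/andP; split.
    apply: (@le_trans _ _ (mu (shift k T))); last by rewrite muk.
    by apply: le_measure; rewrite ?inE//; exact: subDsetl.
  have : (mu (shift k T) <= mu P + mu overlaps)%E.
    apply: le_trans (measureU2 _ mP measurable_overlaps).
    apply: le_measure; rewrite ?inE//; first exact: measurableU.
    by move=> y ky; have [?|?] := pselect (overlaps y); [right|left].
  by rewrite overlaps0 adde0; apply: le_trans; rewrite muk.
have gE y : P y -> g y = g x.
  case: Sg => [ks [c ->]] [ky yN]; apply: eq_bigr => l _; congr (_ * _).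
  rewrite !eE /cindic !indicE; congr ((_ : bool)%:R).
  apply/idP/idP; rewrite !inE => H.
    by rewrite (no_overlap yN H ky).
  by rewrite (no_overlap xN H kx).
rewrite -[leLHS]mul1e -muP -integral_indicMr ?lee_fin ?abs2_ge0//.
apply: ge0_le_integral => //.
- by move=> y _; rewrite mule_ge0// ?lee_fin// abs2_ge0.
- by apply: emeasurable_funM; [exact/measurable_EFinP/measurable_indic|exact: measurable_cst].
- exact: emeasurable_abs2.
- move=> y _; rewrite indicE; have [Py|nPy] := pselect (P y).
    by rewrite mem_set// mul1e gE.
  by rewrite memNset// mul0e lee_fin abs2_ge0.
Qed.

(** A function g of V0 is close to a combination h.  Off a set where |g - h|^2
    is large, which is small by Chebyshev's inequality, |g|^2 is at most about
    2 |h|^2 by [abs2D]; further |h|^2 <= ||h||^2 almost everywhere by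
    [span_bound], and ||h||^2 is at most about 2 ||g||^2 by [sqintD]. *)
Let V0_bound g (c : R) : V0 g -> (4%:E * sqint g < c%:E)%E ->
  {ae mu, forall x, abs2 (g x) <= c}.
Proof.
move=> V0g gc; have /L2P[mg g2] := csub_L2 cV0 V0g.
have [S SE] : exists S : R, sqint g = S%:E.
  by exists (fine (sqint g)); rewrite fineK// ge0_fin_numE// sqint_ge0.
move: gc; rewrite SE -EFinM lte_fin => gc.
(* Where c < |g|^2, off the overlaps, |g - h|^2 > 2 eta - 2 eps >= eta. *)
pose eta := (c - 4 * S) / 4.
have eta0 : 0 < eta by rewrite divr_gt0// subr_gt0.
pose E := [set x | c < abs2 (g x)].
have mE : measurable E.
  rewrite (_ : E = (fun x => abs2 (g x)) @^-1` `]c, +oo[%classic).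
    by apply: preimage_measurable; [exact: measurable_abs2|exact: measurable_itv].
  by apply/seteqP; split => x /=; rewrite in_itv /= andbT.
suff E0 : mu E = 0%E.
  exists E; split => // x /= /negP; rewrite -ltNge; exact.
have small (eps : R) : 0 < eps -> eps <= eta / 2 -> (eta%:E * mu E <= eps%:E)%E.
  move=> eps0 epseta.
  have /L2closureP[_ /(_ _ eps0)[h Sh gh]] := V0g.
  have /L2P[mh _] := lin_span_L2 e_L2 Sh.
  have mgh : cmeasurable (fun x => g x - h x) by exact: cmeasurableB.
  have hS : (sqint h <= (2 * S + 2 * eps)%:E)%E.
    rewrite (_ : h = fun x => g x + - (g x - h x)); last first.
      by apply/funext => x; rewrite opprB addrC subrK.
    apply: (le_trans (sqintD mg (cmeasurableN mgh))).
    rewrite [leRHS](_ : _ = (2%:E * S%:E + 2%:E * eps%:E)%E) ?EFinD ?EFinM//.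
    by rewrite SE sqintN leeD2l// lee_pmul2l ?lte_fin// ltW.
  have mabs := emeasurable_abs2 mgh.
  pose E' := setT `&` [set x | (eta%:E <= `|(abs2 (g x - h x))%:E|)%E].
  have mE' : measurable E'.
    by apply: emeasurable_fun_c_infty => //; exact: measurableT_comp.
  have cheb : (eta%:E * mu E' <= eps%:E)%E.
    apply: (le_trans (le_integral_abse mu measurableT mabs eta0)).
    apply: le_trans (ltW gh); rewrite /sqint.
    by under eq_integral do rewrite gee0_abs ?lee_fin ?abs2_ge0//.
  apply: le_trans cheb; rewrite lee_pmul2l ?lte_fin//.
  have : (mu E <= mu E' + mu overlaps)%E.
    apply: le_trans (measureU2 _ mE' measurable_overlaps).
    apply: le_measure; rewrite ?inE//; first exact: measurableU.
    move=> x Ex; have [xN|xN] := pselect (overlaps x); [by right|left].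
    split => //=; rewrite lee_fin ger0_norm ?abs2_ge0//.
    have hx : abs2 (h x) <= 2 * S + 2 * eps.
      by rewrite -lee_fin; apply: le_trans hS; exact: span_bound.
    have := abs2D (g x - h x) (h x); rewrite subrK => gx.
    by move: Ex epseta; rewrite /E /eta /=; lra.
  by rewrite overlaps0 adde0.
have H : (eta%:E * mu E <= 0)%E.
  apply/lee_addgt0Pr => eps eps0; rewrite add0e.
  apply: (@le_trans _ _ (Num.min eps (eta / 2))%:E).
    by apply: small; [rewrite lt_min eps0 divr_gt0|rewrite ge_min lexx orbT].
  by rewrite lee_fin ge_min lexx.
by apply/eqP; rewrite eq_le measure_ge0 andbT -(pmule_rle0 _ (_ : 0 < eta%:E)%E) ?lte_fin.
Qed.

Let pw (j : int) : 'M[R]_n.+1 := Am ^ j.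

Let unit_pw j : pw j \in unitmx.
Proof. by rewrite /pw -[_ \in _]/(_ \is a GRing.unit) unitrXz. Qed.

Let pwD i j : pw (i + j) = pw i *m pw j.
Proof. by rewrite /pw exprzDr. Qed.

Let pw0 : pw 0 = 1%:M. Proof. by []. Qed.

Let pwM i j (x : 'cV[R]_n.+1) : pw i *m (pw j *m x) = pw (i + j) *m x.
Proof. by rewrite mulmxA pwD. Qed.

Let pw_Am (x : 'cV[R]_n.+1) : Am *m x = pw 1 *m x. Proof. by []. Qed.

Let pw_B (x : 'cV[R]_n.+1) : B *m x = pw (-1) *m x. Proof. by []. Qed.

Let V (j : int) : set ('cV[R]_n.+1 -> R[i]) :=
  [set f | V0 (fun x => f (pw (- j) *m x))].

Let cV j : closed_subspace (V j).
Proof. exact: csub_comp (unit_pw _) cV0. Qed.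

Let V_nested j : V j `<=` V (j + 1).
Proof.
move=> f /= /V0_refine; congr V0; apply/funext => x.
by rewrite pw_B pwM opprD.
Qed.

Let V_nested_le i (k : nat) : V i `<=` V (i + k%:Z).
Proof.
elim: k => [|k IHk] f Vf; first by rewrite addr0.
by rewrite -addn1 PoszD addrA; apply: V_nested; exact: IHk.
Qed.

Let V_V0 : V 0 = V0.
Proof.
apply/seteqP; split => f; rewrite /V /= oppr0 pw0; congr V0;
by apply/funext => x; rewrite mul1mx.
Qed.

Let V_dilation j f : V j f <-> V (j + 1) (fun x => f (Am *m x)).
Proof.
rewrite /V /=; suff -> : (fun x => f (Am *m (pw (- (j + 1)) *m x))) =
  (fun x => f (pw (- j) *m x)) by [].
by apply/funext => x; rewrite pw_Am pwM opprD addrCA subrr addr0.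
Qed.

Let V_translation f k : V 0 f <-> V 0 (fun x => f (x - Z k)).
Proof.
rewrite V_V0; split; first exact: V0_translate.
move=> /(V0_translate (- k)); congr V0; apply/funext => x.
by rewrite /intmx map_mxN opprK addrK.
Qed.

Let Rintegral_cindic (E : set 'cV[R]_n.+1) : measurable E ->
  (\int[mu]_x (\1_E x : R))%R = fine (mu E).
Proof. by move=> mE; rewrite /Rintegral integral_indic// setIT. Qed.

Let V_scaling : scaling_function V (cindic T).
Proof.
have eb : (fun (k : 'cV[int]_n.+1) x => cindic T (x - Z k)) = e by [].
split.
  rewrite V_V0 (_ : cindic T = e 0); first exact: V0_e.
  by apply/funext => x; rewrite /e intmx0 subr0.
rewrite V_V0 eb; split => [k|k l|f]; [exact: V0_e| |exact].
rewrite /L2dot.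
have -> : (fun x => complex.Re (e k x * (e l x)^*)) = \1_(shift k T `&` shift l T).
  apply/funext => x; rewrite !eE /cindic !indicE in_setI.
  by case: (x \in shift k T); case: (x \in shift l T); rewrite ?rmorph1 ?rmorph0 ?mul0r ?mulr0 ?mulr1.
have -> : (fun x => complex.Im (e k x * (e l x)^*)) = \1_(set0 : set 'cV[R]_n.+1).
  apply/funext => x; rewrite !eE /cindic !indicE in_set0.
  by case: (x \in shift k T); case: (x \in shift l T); rewrite ?rmorph1 ?rmorph0 ?mul0r ?mulr0 ?mulr1.
rewrite !Rintegral_cindic//; last exact: measurableI.
rewrite measure0; case: eqVneq => [->|kl].
  by rewrite setIid lebesgue_shift// muT.
by rewrite packT.
Qed.

(** For f in the space of index -m, the function f(A^m .) is in V0 and its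
    squared norm carries a factor tending to 0 with m, so the bound on V0 makes
    f vanish.  The term 1 in c gives the strict inequality that this bound
    requires, even if f has norm 0. *)
Let V_trivial : \bigcap_j V j = @L2null R n.+1.
Proof.
apply/seteqP; split => [f Vf|f [Lf f0] j _]; last first.
  apply: (csub_ae (cV j) (csub_0 (cV j))); first by have /L2P[] := Lf.
  by apply: filterS f0 => x; exact.
have Lf : L2 f by exact: (csub_L2 (cV 0) (Vf 0 I)).
split => //; have /L2P[mf f2] := Lf.
have [S SE] : exists S : R, sqint f = S%:E.
  by exists (fine (sqint f)); rewrite fineK// ge0_fin_numE// sqint_ge0.
pose c := 4 * S + 1.
have uAm m : Am ^+ m \in unitmx by exact: unitmxX.
have bound m : {ae mu, forall x, abs2 (f x) <= modulus Am ^+ m * c}.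
  have lm0 : 0 < modulus Am ^+ m by rewrite exprn_gt0// modulus_gt0.
  have V0f : V0 (fun x => f (Am ^+ m *m x)).
    by have := Vf (- m%:Z) I; rewrite /V /= opprK.
  have [|N [mN N0 NP]] := @V0_bound _ (modulus Am ^+ m * c) V0f.
    rewrite sqint_comp_mulmx// modulusX// SE -!EFinM lte_fin mulrCA.
    by rewrite ltr_pM2l// ltrDl.
  pose E := [set x | modulus Am ^+ m * c < abs2 (f x)].
  have mE : measurable E.
    rewrite (_ : E = (fun x => abs2 (f x)) @^-1` `]modulus Am ^+ m * c, +oo[%classic).
      by apply: preimage_measurable; [exact: measurable_abs2|exact: measurable_itv].
    by apply/seteqP; split => x /=; rewrite in_itv /= andbT.
  exists E; split => //; last by move=> x /= /negP; rewrite -ltNge; exact.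
  have := mulmx_preimageE (uAm m) mE; rewrite modulusX// => H.
  have : mu ((fun x => Am ^+ m *m x) @^-1` E) = 0%E.
    apply/eqP; rewrite -measure_le0 -N0; apply: le_measure; rewrite ?inE//.
      by apply: preimage_measurable => //; exact: measurable_mulmx.
    by move=> x /= Ex; apply: NP => /=; apply/negP; rewrite -ltNge.
  move=> /eqP; rewrite {}H mule_eq0 eqe gt_eqF//= => /eqP; exact.
have := ae_foralln bound; apply: filterS => x H _ /=.
apply/eqP; rewrite -abs2_eq0 eq_le abs2_ge0 andbT.
have lim0 : modulus Am ^+ m * c @[m --> \oo] --> 0 * c.
  apply: cvgM; last exact: cvg_cst.
  by apply: cvg_expr; rewrite ger0_norm ?modulus_ge0.
rewrite mul0r in lim0; rewrite -(cvg_lim _ lim0)//; apply: limr_ge; last exact: nearW.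
by apply/cvg_ex; exists 0.
Qed.

Let L2_bigcupV : \bigcup_j V j `<=` @L2 R n.+1.
Proof. by move=> f [j _ Vf]; exact: csub_L2 (cV j) _ Vf. Qed.

Let cW : closed_subspace (L2closure (\bigcup_j V j)).
Proof.
apply: closed_subspace_closure => //.
- by exists 0 => //; exact: csub_0 (cV 0).
- move=> f g [i _ Vf] [j _ Vg].
  have [k [k' kk']] : exists k k' : nat, i + k%:Z = j + k'%:Z.
    have [ij|ji] := leP i j.
      by exists (absz (j - i)), 0%N; lia.
    by exists 0%N, (absz (i - j)); lia.
  exists (i + k%:Z) => //; apply: (csub_add (cV _)); first exact: V_nested_le.
  by rewrite kk'; exact: V_nested_le.
- by move=> z f [j _ Vf]; exists j => //; exact: csub_scale (cV j) _ _ Vf.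
Qed.

Let tile_at m k : set 'cV[R]_n.+1 := (fun x => Am ^+ m *m x) @^-1` shift k T.

(** The tiles of level m contained in O are finitely many since O is bounded,
    and a point of O belongs to one of them as soon as the diameter of the
    tiles is less than its distance to the complement of O. *)
Let cindic_open (rad : R) (O : set 'cV[R]_n.+1) : open O -> measurable O -> O `<=` open_box rad ->
  L2closure (\bigcup_j V j) (cindic O).
Proof.
move=> oO mO Orad.
pose S m := [set k | tile_at m k `<=` O].
have fS m : finite_set (S m).
  have [k0 t0T] := covT 0; set t0 := 0 - Z k0 in t0T.
  apply: (sub_finite_set _ (finite_bounded_lattice n.+1
    (\sum_i \sum_j `|(Am ^+ m) i j| * `|rad| + \sum_i `|t0 i ord0|))) => k Sk i.
  pose x := B ^+ m *m (t0 + Z k).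
  have AmK (y : 'cV[R]_n.+1) : Am ^+ m *m (B ^+ m *m y) = y.
    by have := @invmx_expK _ _ B m y; rewrite invmxK unitmx_inv; exact.
  have xrad : open_box rad x.
    by apply/Orad/Sk; rewrite /tile_at /shift /= /x AmK addrK.
  have -> : Z k = Am ^+ m *m x - t0 by rewrite /x AmK addrC addKr.
  rewrite mxE [X in _ + X]mxE (le_trans (ler_normB _ _))// lerD//.
    rewrite mxE (le_trans (ler_norm_sum _ _ _))// [leRHS](bigD1 i)//= ler_wpDr//.
      by apply: sumr_ge0 => l _; apply: sumr_ge0 => j _; rewrite mulr_ge0.
    apply: ler_sum => j _; rewrite normrM ler_wpM2l//.
    by rewrite (le_trans (ltW (xrad j)))// ler_norm.
  by rewrite [leRHS](bigD1 i)//= ler_wpDr// sumr_ge0.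
pose O_ m := \bigcup_(k in S m) tile_at m k.
have OS m : O_ m `<=` O by move=> x [k Sk]; exact: Sk.
pose bad := \bigcup_m ((fun x => Am ^+ m *m x) @^-1` overlaps).
have uAm m : Am ^+ m \in unitmx by exact: unitmxX.
have mbad_ m : measurable ((fun x => Am ^+ m *m x) @^-1` overlaps).
  by apply: preimage_measurable => //; exact: measurable_mulmx.
have bad0 : mu.-negligible bad.
  apply: negligible_bigcup => m; apply/negligibleP => //.
  have := mulmx_preimageE (uAm m) measurable_overlaps.
  by rewrite overlaps0 mule0; exact.
pose u m (x : 'cV[R]_n.+1) := \sum_(k <- finmap.enum_fset (fset_set (S m))) e k (Am ^+ m *m x).
have uE m x : ~ bad x -> u m x = cindic (O_ m) x.
  move=> xN; rewrite /u sum_translates; last 2 first.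
  - exact: finmap.fset_uniq.
  - by move=> H; apply: xN; exists m.
  rewrite /cindic !indicE; congr ((_ : bool)%:R); apply/idP/idP; rewrite !inE.
    by move=> [k /= + kx]; rewrite in_fset_set// inE => Sk; exists k.
  by move=> [k Sk kx]; exists k => //=; rewrite in_fset_set// inE.
apply: (@csub_dominated _ _ _ u _ (\1_(open_box rad))) => //.
- move=> m; apply: sub_L2closure => //; exists m%:Z => //.
  rewrite /V /= (_ : (fun x => _) = (fun x =>
     \sum_(k <- finmap.enum_fset (fset_set (S m))) e k x)); first exact: csub_sum.
  apply/funext => x; apply: eq_bigr => k _; congr e.
  by rewrite -[Am ^+ m]/(pw m%:Z) pwM subrr pw0 mul1mx.
- exact: cmeasurable_indic.
- by apply: measurable_indic; exact: measurable_open_box.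
- rewrite integral_indic//; last exact: measurable_open_box.
  by rewrite setIT; exact: lebesgue_open_box_lty.
- apply: (negligibleS _ bad0) => x /= nP; apply: contrapT => xN; apply: nP => m.
  rewrite uE// /cindic abs2_indic !indicE ler_nat.
  have : x \in (O `\` O_ m) `|` (O_ m `\` O) -> x \in open_box rad.
    by rewrite !inE => -[[/Orad ?]|[/OS /Orad ?]].
  by case: (x \in _) => // ->.
apply: (negligibleS _ bad0) => x /= nP; apply: contrapT => xN; apply: nP.
apply: cvg_near_cst; have [Ox|nOx] := pselect (O x); last first.
  by apply: nearW => m; rewrite uE// /cindic !indicE !memNset ?subrr ?abs2_0// => /OS.
have /nbhs_ballP[eps eps0 Heps] : nbhs x O by apply: open_nbhs_nbhs.
have rs0 : r * s ^+ m + r * s ^+ m @[m --> \oo] --> r * 0 + r * 0.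
  have sN : s ^+ m @[m --> \oo] --> (0 : R) by apply: cvg_expr; rewrite ger0_norm// ltW.
  by apply: cvgD; apply: cvgM => //; exact: cvg_cst.
rewrite !mulr0 addr0 in rs0.
have [N _ HN] := cvgr_lt _ rs0 _ eps0.
exists N => // m /= Nm; have [k kx] := covT (Am ^+ m *m x).
suff Omx : O_ m x by rewrite uE// /cindic !indicE !mem_set// subrr abs2_0.
exists k => // y ky; apply: Heps; split => // i j; rewrite ord1 /ball /=.
have -> : x i ord0 - y i ord0 = (B ^+ m *m (Am ^+ m *m x - Z k)) i ord0 -
    (B ^+ m *m (Am ^+ m *m y - Z k)) i ord0.
  have -> : x i ord0 - y i ord0 = (x - y) i ord0 by rewrite !mxE.
  rewrite -[x - y](invmx_expK m _ uA) mulmxBr.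
  have -> : Am ^+ m *m x - Am ^+ m *m y = (Am ^+ m *m x - Z k) - (Am ^+ m *m y - Z k).
    by rewrite opprB addrA subrK.
  by rewrite mulmxBr mxE [X in _ + X]mxE.
apply: (le_lt_trans (ler_normB _ _)); apply: le_lt_trans (HN m Nm).
by rewrite lerD//; apply: decayT.
Qed.

Let V_dense : L2closure (\bigcup_j V j) = @L2 R n.+1.
Proof.
apply/seteqP; split => [f []//|f Lf].
by apply: (L2_sub_closed_subspace cW) Lf => rad O; exact: cindic_open.
Qed.

Lemma tiling_scaling_function : is_scaling_function_for A (cindic T).
Proof.
exists V; last exact: V_scaling.
split.
- exact: cV.
- exact: V_nested.
- exact: V_dense.
- exact: V_trivial.
- exact: V_dilation.
- exact: V_translation.
- by exists (cindic T); exact: V_scaling.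
Qed.

End tiling_multiresolution.

(** * Singular values and the digits in the image of a cube *)

Section singular_values.
Context (R : realType) (n : nat).
Implicit Types (A : 'M[int]_n).

Definition sqnorm (x : 'cV[R]_n) : R := \sum_i x i ord0 ^+ 2.

Lemma sqnorm_ge0 x : 0 <= sqnorm x.
Proof. by apply: sumr_ge0 => i _; exact: sqr_ge0. Qed.

Lemma sqnorm_eq0 x : (sqnorm x == 0) = (x == 0).
Proof.
apply/eqP/eqP => [|->]; last by apply: big1 => i _; rewrite mxE expr0n.
move=> /psumr_eq0P H; apply/colP => i; rewrite mxE; apply/eqP.
by rewrite -sqrf_eq0 H// => j _; exact: sqr_ge0.
Qed.

Lemma sqnormE x : sqnorm x = (x^T *m x) ord0 ord0.
Proof. by rewrite mxE; apply: eq_bigr => i _; rewrite mxE expr2. Qed.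

Local Notation c := (real_complex R).

(** Over the complex numbers S is diagonal in a unitary basis.  The diagonal
    entries are real, so they are eigenvalues of S over the reals. *)
Lemma rayleigh (S : 'M[R]_n) (m : R) (x : 'cV[R]_n) : S^T = S ->
  (forall l, eigenvalue S l -> m <= l) ->
  m * sqnorm x <= (x^T *m S *m x) ord0 ord0.
Proof.
move=> symS Sm; pose B := map_mx c S.
have hB : B \is hermsymmx.
  apply: realsym_hermsym.
    apply/is_hermitianmxP; rewrite expr0 scale1r map_mx_id//.
    by rewrite /B map_trmx symS.
  by apply/mxOverP => i j; rewrite mxE; apply/complex_realP; exists (S i j).
have /orthomx_spectralP BE := hermitian_normalmx hB.
have /mxOverP dreal := hermitian_spectral_diag_real hB.
set P := spectralmx B in BE; set d := spectral_diag B in BE dreal.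
have uP : P \is unitarymx by exact: spectral_unitarymx.
have Pu : P \in unitmx by exact: spectral_unit.
have dm i : c m <= d ord0 i.
  have /complex_realP[r dr] := dreal ord0 i; rewrite dr lecR; apply: Sm.
  have : eigenvalue B (c r).
    apply/eigenvalueP; exists (row i P); last first.
      apply/eqP => /(congr1 (mulmx^~ (invmx P))); rewrite -row_mul mulmxV// mul0mx.
      by move=> /rowP/(_ i); rewrite !mxE eqxx => /eqP; rewrite oner_eq0.
    rewrite BE !mulmxA -row_mul mulmxV// -row_mul mul1mx -row_mul mul_diag_mx.
    by apply/rowP => j; rewrite !mxE -dr.
  by rewrite !eigenvalue_root_char -(map_char_poly c) fmorph_root.
rewrite -lecR.
pose xc := map_mx c x; pose y := P *m xc.
have xcE : map_mx Num.conj xc^T = map_mx c x^T.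
  by apply/matrixP => i j; rewrite !mxE conj_Creal//; apply/complex_realP; exists (x j i).
have yE : map_mx Num.conj y^T = map_mx c x^T *m invmx P.
  by rewrite trmx_mul map_mxM xcE invmx_unitary.
have -> : c ((x^T *m S *m x) ord0 ord0) = \sum_i d ord0 i * `|y i ord0| ^+ 2.
  transitivity ((map_mx c x^T *m B *m xc) ord0 ord0); first by rewrite /B /xc -!map_mxM [RHS]mxE.
  rewrite BE !mulmxA -yE -(mulmxA _ P) -/y mxE; apply: eq_bigr => i _.
  rewrite mul_mx_diag !mxE normCK; ring.
have -> : c (m * sqnorm x) = \sum_i c m * `|y i ord0| ^+ 2.
  rewrite rmorphM -mulr_sumr; congr (_ * _); rewrite sqnormE.
  transitivity ((map_mx c x^T *m xc) ord0 ord0); first by rewrite /B /xc -!map_mxM [RHS]mxE.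
  rewrite -(mulmxKV Pu (map_mx c x^T)) -yE -mulmxA -/y mxE; apply: eq_bigr => i _.
  by rewrite !mxE normCK mulrC.
by apply: ler_sum => i _; rewrite ler_wpM2r// exprn_ge0.
Qed.

Lemma singular_value_bound A (mu : R) (x : 'cV[R]_n) :
  smallest_singular_value A mu -> mu ^+ 2 * sqnorm x <= sqnorm (intmx R A *m x).
Proof.
move=> [[mu0 _] mu_min]; rewrite [leRHS]sqnormE trmx_mul -mulmxA (mulmxA _ _ x) mulmxA.
apply: rayleigh => [|l Sl]; first by rewrite trmx_mul trmxK.
have l0 : 0 <= l.
  have /eigenvalueP[v vS v0] := Sl.
  have vp : 0 < sqnorm v^T.
    by rewrite lt_neqAle sqnorm_ge0 eq_sym sqnorm_eq0 trmx_eq0 v0.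
  rewrite -(pmulr_lge0 _ vp) (_ : _ * _ = sqnorm (intmx R A *m v^T)) ?sqnorm_ge0//.
  rewrite !sqnormE trmx_mul trmxK -mulmxA (mulmxA _ _ v^T) mulmxA vS -scalemxAl [RHS]mxE mulrC.
  by [].
rewrite -(sqr_sqrtr l0) ler_sqr ?nnegrE ?sqrtr_ge0//; apply: mu_min.
by split; rewrite ?sqrtr_ge0// sqr_sqrtr.
Qed.
End singular_values.

Section cube_digits.
Context (R : realType) (n : nat) (A : 'M[int]_n).
Local Notation Z := (@intmx R n 1).
Hypothesis uA : intmx R A \in unitmx.

(** Rounding half up, so that what is left lies in the half-open cube. *)
Let nearest (y : 'cV[R]_n) : 'cV[int]_n := \col_i Num.floor (y i ord0 + 2^-1).

Let nearest_spec (y : 'cV[R]_n) i : - 2^-1 <= y i ord0 - (nearest y i ord0)%:~R < 2^-1.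
Proof.
rewrite mxE; have := floor_itv (y i ord0 + 2^-1) => /andP[h1 h2].
move: h1 h2; rewrite intrD /=; move: (Num.floor _)%:~R => k *; apply/andP; split; lra.
Qed.

Let nearest_unique (y : 'cV[R]_n) (k : 'cV[int]_n) :
  (forall i, - 2^-1 <= y i ord0 - (k i ord0)%:~R < 2^-1) -> k = nearest y.
Proof.
move=> kP; apply/colP => i.
have H (a b : int) (t : R) : - 2^-1 <= t - a%:~R -> t - b%:~R < 2^-1 -> a <= b.
  move=> ha hb; rewrite -ltzD1 -(ltr_int R) intrD; lra.
have /andP[k0 k1] := kP i; have /andP[l0 l1] := nearest_spec y i.
by apply/eqP; rewrite eq_le (H _ _ _ k0 l1) (H _ _ _ l0 k1).
Qed.

Lemma cube_digits_digit_set : digit_set A (cube_digits R A).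
Proof.
split.
  exists 0; last by rewrite mulmx0 intmx0.
  by move=> i; rewrite mxE; apply/andP; split; lra.
move=> x; pose y := invmx (intmx R A) *m Z x; pose m := nearest y.
exists (x - A *m m); split.
  split; last by exists m; rewrite subrK.
  exists (y - Z m).
    by move=> i; rewrite mxE [X in _ + X]mxE intmxE; exact: nearest_spec.
  by rewrite mulmxBr mulKVmx// intmxB intmxM.
move=> d [[f fF fd] [m' xE]].
suff -> : m = m' by rewrite xE addrK.
apply/esym/nearest_unique => i.
have -> : y = f + Z m'.
  by rewrite /y xE intmxD intmxM -fd -mulmxDr mulKmx.
by rewrite mxE [Z m' _ _]mxE addrK.
Qed.

(** If x = d + A m with d a digit, then m is A^(-1) x rounded coordinatewise.
    Rounding at most doubles each coordinate, so the squared length of m is at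
    most 4 / mu^2 < 1 times that of x, and the division ends at 0. *)
Lemma cube_digits_radix (mu : R) : smallest_singular_value A mu -> 2 < mu ->
  radix_representation A (cube_digits R A).
Proof.
move=> muA mu2; have [D0 Dex] := cube_digits_digit_set.
pose nrm (x : 'cV[int]_n) : nat := (\sum_i (absz (x i ord0)) ^ 2)%N.
have nrmE x : sqnorm (Z x) = (nrm x)%:R.
  rewrite /nrm natr_sum; apply: eq_bigr => i _.
  by rewrite intmxE natrX pmulrn abszE intr_norm real_normK ?num_real.
move=> x; have [N] := ubnP (nrm x); elim: N => // N IHN in x *; rewrite ltnS => xN.
have [->|x0] := eqVneq x 0.
  by exists 0%N, (fun=> 0); split=> //; rewrite big_nat1 mulmx0.
pose y := invmx (intmx R A) *m Z x.
have [d [[dD [m xE]] _]] := Dex x.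
have mE : m = nearest y.
  case: dD => f fF fd; apply: nearest_unique => i.
  have -> : y = f + Z m by rewrite /y xE intmxD intmxM -fd -mulmxDr mulKmx.
  by rewrite mxE [Z m _ _]mxE addrK.
have lemx : (nrm m < nrm x)%N.
  rewrite -(ltr_nat R) -!nrmE.
  have xp : 0 < sqnorm (Z x).
    rewrite lt_neqAle sqnorm_ge0 eq_sym sqnorm_eq0 andbT.
    by rewrite -(intmx0 R) (inj_eq (@intmx_inj R _ _)).
  have my : sqnorm (Z m) <= 4 * sqnorm y.
    rewrite /sqnorm mulr_sumr; apply: ler_sum => i _; rewrite mE.
    have := nearest_spec y i; rewrite intmxE; move: (nearest y i ord0) => k.
    move: (y i ord0) => t /andP[h1 h2].
    have [k0|k0|->] := ltgtP k 0; last by rewrite expr0n /= mulr_ge0// sqr_ge0.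
      have : (k + 1)%:~R <= 0 :> R by rewrite -[0]/(0%:~R) ler_int; lia.
      rewrite intrD; nra.
    have : 1 <= k%:~R :> R by rewrite -[1]/(1%:~R) ler_int; lia.
    nra.
  have := singular_value_bound y muA; rewrite mulKVmx// => yx.
  have mu4 : 4 < mu ^+ 2 by nra.
  have y0 := sqnorm_ge0 y.
  have [y00|yp] := eqVneq (sqnorm y) 0; first by rewrite (le_lt_trans my)// y00 mulr0.
  apply: (le_lt_trans my); apply: lt_le_trans yx; rewrite ltr_pM2r//.
  by rewrite lt_neqAle eq_sym yp.
have [N' [d' [d'D mS]]] := IHN m (leq_trans lemx xN).
exists N'.+1, (fun j => if j is j'.+1 then d' j' else d); split.
  by case=> [//|j]; exact: d'D.
rewrite big_nat_recl// expr0 mul1mx xE {1}mS mulmx_sumr; congr (_ + _).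
by apply: eq_bigr => j _; rewrite exprS mulmxA.
Qed.
End cube_digits.

(** * Scaling functions from radix representations *)

Lemma tile_scaling_function (R : realType) n (A : 'M[int]_n.+1) (D : set 'cV[int]_n.+1) :
  dilation_matrix R A -> digit_set A D -> radix_representation A D ->
  is_scaling_function_for A (@tile_indicator R n.+1 A D).
Proof.
move=> dilA digD radD; have uA := dilation_unitmx dilA.
have [s [K [s0 s1 K0 decay]]] := dilation_decay dilA.
have [r _ decayT] := tile_decay uA s0 s1 K0 decay digD.
apply: (@tiling_scaling_function R n A D (tile A D) uA (finite_digits uA digD)
  _ _ _ _ _ r s) => //.
- exact (measurable_tile uA s0 s1 K0 decay digD).
- exact (lebesgue_tile uA s0 s1 K0 decay digD radD).
- exact (tile_ae_packs uA s0 s1 K0 decay digD radD).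
- exact (tile_covers uA s0 s1 K0 decay digD).
- exact (tileE uA s0 s1 K0 decay digD).
- exact (modulus_lt1 uA s0 s1 K0 decay).
Qed.

Theorem theorem13 (R : realType) (n : nat) (n_gt0 : (0 < n)%N)
    (A : 'M[int]_n) (dilA : dilation_matrix R A) :
  (forall D : set 'cV[int]_n,
     digit_set A D -> radix_representation A D ->
     is_scaling_function_for A (@tile_indicator R n A D)) /\
  (forall mu : R, smallest_singular_value A mu -> 2 < mu ->
     is_scaling_function_for A (@tile_indicator R n A (cube_digits R A))).
Proof.
case: n n_gt0 A dilA => // n _ A dilA; have uA := dilation_unitmx dilA.
split=> [D|mu muA mu2]; first exact: tile_scaling_function.
apply: tile_scaling_function => //; first exact: cube_digits_digit_set.
exact: cube_digits_radix muA mu2.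
Qed.
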